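(* Let $(A,+,\times,0_A,1_A)$ be a semiring, $B$ a set, $\Omega$ an $A$-pre-morphism with weights in $B$, $H$ an $\mathbf{e}$-free edge-labelled graph, $\mathbb{H}$ an optimal contraction sequence of $H$, $X$ a finite set and $\mathcal{R}\subseteq X\times X_H$ (with $\mathbb{H}$, $\mathcal{R}$, $\Omega$ fixed). Then there is an algorithm which, on every instance $G$ on $n\geq1$ vertices (an $\mathbf{e}$-free edge-labelled graph with $X_G=X$) together with a weight matrix $W\in B^{V_G\times V_H}$, outputs $\Omega_W(\{f : f\text{ is an }\mathcal{R}\text{-morphism from }G\text{ to }H\})$ in time $O\big((\mathrm{ctww}(H)+2)^{|V_G|}\cdot|V_G|^2\big)$.
   Context: An edge-labelled graph is $G=(V_G,l_G,X_G)$ with $V_G,X_G$ finite sets and $l_G:V_G^2\to X_G$. A special symbol $\mathbf{e}$ is used; $G$ is $\mathbf{e}$-free if $\mathbf{e}\notin X_G$. For $\mathbf{e}$-free $G,H$ and $\mathcal{R}\subseteq X_G\times X_H$, $f:V_G\to V_H$ is an $\mathcal{R}$-morphism if $(l_G(u,v),l_H(f(u),f(v)))\in\mathcal{R}$ for all $(u,v)\in V_G^2$. Contraction: for a partition $\mathcal{S}$ of $V_H$ into nonempty parts, $H_{\mathcal{S}}$ has vertex set $\mathcal{S}$, label set $X_H\cup\{\mathbf{e}\}$, and $l_{H_{\mathcal{S}}}(S_1,S_2)=x$ if $l_H(u,v)=x$ for all $(u,v)\in S_1\times S_2$, and $\mathbf{e}$ otherwise. A contraction sequence of $H$ with $m$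 vertices is $(H_m,\dots,H_1)$, $H_m=H$, $H_k$ the contraction relative to a partition $\mathcal{P}_k$ with $k$ parts, $\mathcal{P}_m$ the singletons, each $\mathcal{P}_k$ obtained from $\mathcal{P}_{k+1}$ by merging two parts. $\mathbf{e}$-connected components: connected components of the undirected graph with edge $\{u,v\}$ iff $\mathbf{e}\in\{l(u,v),l(v,u)\}$. Component-width of a sequence: maximum number of vertices of an $\mathbf{e}$-connected component of $H_{m-1},\dots,H_1$; $\mathrm{ctww}(H)$ is its minimum over all sequences; a sequence attaining it is optimal. Semiring: $(A,+,0_A)$ commutative monoid, $(A,\times,1_A)$ monoid, distributivity, $0_A$ absorbing. For disjoint $S_1,S_2$ and $f_i:S_i\to T_i$, the join $f_1\bowtie f_2:S_1\uplus S_2\to T_1\cup T_2$ restricts to $f_i$ on $S_i$; $\mathcal{F}_1\bowtie\mathcal{F}_2=\{f_1\bowtie f_2\}$. An $A$-pre-morphism with weights in $B$ assigns to all edge-labelled graphs $G,H$, $S\subseteq V_G$, $T\subseteq V_H$, sets $\mathcal{F}$ of functions $S\to T$ and $W\in B^{V_G\times V_H}$ a value $\Omega_W(\mathcal{F})\in A$ with: (i) $\Omega_W(\mathcal{F}_1\uplus\mathcal{F}_2)=\Omega_W(\mathcal{F}_1)+\Omega_W(\mathcal{F}_2)$ for disjoint sets of functions $S\to T$; (ii) $\Omega_W(\mathcal{F}_1\bowtie\mathcal{F}_2)=\Omega_W(\mathcal{F}_1)\times\Omega_W(\mathcal{F}_2)$ for $\mathcal{F}_i$ sets of functions $S_i\to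 T_i$ with $S_1\cap S_2=\emptyset$ and $T_1\cap T_2=\emptyset$; (iii) $\Omega_W(\emptyset)=0_A$. *)

(* Defs.v *)
From HB Require Import structures.
From mathcomp Require Import all_boot all_order all_algebra.

Set Implicit Arguments.
Unset Strict Implicit.
Unset Printing Implicit Defensive.

(* Edge-labelled graphs.  The special symbol e is [None]: a graph whose label
   set is X is e-free, and a graph whose labels may be e has label set
   [option X], so that [option] plays the role of X |-> X u {e}. *)
Record elgraph := ELGraph {
  vertex :> finType;
  label : finType;
  lab : vertex -> vertex -> label
}.

Arguments ELGraph {vertex label} lab.

Definition is_morphism (G H : elgraph) (R : {set label G * label H})
    (f : {ffun G -> H}) : bool :=
  [forall u : G, forall v : G, (lab u v, lab (f u) (f v)) \in R].

Section Contraction.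
Variable H : elgraph.
Implicit Types (P Q : {set {set H}}) (s : seq {set {set H}}).

(* The x found by [pick] is unique as soon as S1 and S2 are nonempty. *)
Definition contraction_lab P (S1 S2 : {S : {set H} | S \in P}) :
    option (label H) :=
  [pick x | [forall u in val S1, forall v in val S2, lab u v == x]].

Definition contraction P : elgraph := ELGraph (@contraction_lab P).

Definition singletons : {set {set H}} := [set [set x] | x : H].

Definition merge_step P Q : bool :=
  [exists S1 in P, exists S2 in P,
     (S1 != S2) && (Q == (S1 :|: S2) |: (P :\ S1 :\ S2))].

(* The sequence (H_m, ..., H_1) is given by the list of the partitions
   (P_m, ..., P_1); the i-th item of the list (from 0) is P_(m - i). *)
Definition contraction_seq s : bool :=
  [&& size s == #|H|,
      all (fun P => partition P [set: H]) s,
      [forall i : 'I_(size s), #|nth set0 s i| == #|H| - i] &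
      if s is P :: s' then (P == singletons) && path merge_step P s'
      else false].

End Contraction.

Section EConnected.
Variables (V X : finType) (l : V -> V -> option X).

Definition eadj : rel V := [rel u v | (l u v == None) || (l v u == None)].

Definition ecomponent (u : V) : {set V} := [set v | connect eadj u v].

Definition max_ecomponent : nat := \max_(u : V) #|ecomponent u|.

End EConnected.

(* [behead] because H_m = H itself is not taken into account. *)
Definition component_width (H : elgraph) (s : seq {set {set H}}) : nat :=
  \max_(P <- behead s) @max_ecomponent (contraction P) (label H) (@lab (contraction P)).

(* The default value #|H| of the minimum is irrelevant: it exceeds the width of
   every contraction sequence, since H_(m-1), ..., H_1 have < m vertices. *)
Definition ctww (H : elgraph) : nat :=
  \big[minn/#|H|]_(s : #|H|.-tuple {set {set H}} | contraction_seq s)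
     component_width s.

Definition optimal_contraction_seq (H : elgraph) (s : seq {set {set H}}) :=
  contraction_seq s && (component_width s == ctww H).

(* A function S -> T with S a subset of V_G and T a subset of V_H is encoded by
   the partial function from V_G to V_H with the same graph. *)
Definition pfun (G H : elgraph) := {ffun G -> option H}.

Definition functions (G H : elgraph) (S : {set G}) (T : {set H}) :
    {set pfun G H} :=
  [set f : pfun G H |
     [forall u, if u \in S then if f u is Some v then v \in T else false
                else f u == None]].

Definition fjoin (G H : elgraph) (f1 f2 : pfun G H) : pfun G H :=
  [ffun u => if f1 u is Some v then Some v else f2 u].

Definition fjoins (G H : elgraph) (F1 F2 : {set pfun G H}) : {set pfun G H} :=
  [set fjoin f1 f2 | f1 in F1, f2 in F2].

(* The domain S and the codomain T are arguments of [omega] because T cannot be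
   recovered from F; [omega S T W F] is meaningful only when F consists of
   functions S -> T. *)
Record premorphism (A : pzSemiRingType) (B : Type) := PreMorphism {
  omega : forall G H : elgraph,
    {set G} -> {set H} -> (G -> H -> B) -> {set pfun G H} -> A;
  omegaU : forall (G H : elgraph) (S : {set G}) (T : {set H})
      (W : G -> H -> B) (F1 F2 : {set pfun G H}),
    F1 \subset functions S T -> F2 \subset functions S T ->
    [disjoint F1 & F2] ->
    omega S T W (F1 :|: F2) = (omega S T W F1 + omega S T W F2)%R;
  omega_join : forall (G H : elgraph) (S1 S2 : {set G}) (T1 T2 : {set H})
      (W : G -> H -> B) (F1 F2 : {set pfun G H}),
    F1 \subset functions S1 T1 -> F2 \subset functions S2 T2 ->
    [disjoint S1 & S2] -> [disjoint T1 & T2] ->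
    omega (S1 :|: S2) (T1 :|: T2) W (fjoins F1 F2)
      = (omega S1 T1 W F1 * omega S2 T2 W F2)%R;
  omega0 : forall (G H : elgraph) (S : {set G}) (T : {set H})
      (W : G -> H -> B),
    omega S T W set0 = 0%R
}.

(* The R-morphisms from G to H, as functions from V_G to V_H. *)
Definition morphisms (G H : elgraph) (R : {set label G * label H}) :
    {set pfun G H} :=
  [set ([ffun u => Some (f u)] : pfun G H)
     | f : {ffun G -> H} & is_morphism R f].

(* The constant function S -> {v}. *)
Definition const_pfun (G H : elgraph) (S : {set G}) (v : H) : pfun G H :=
  [ffun u => if u \in S then Some v else None].

(* The model of computation: structured programs for a unit-cost random access
   machine with finitely many unbounded arrays of natural numbers and of
   elements of A, all initialised with 0.

   - Arithmetic on natural numbers is limited to addition, truncated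
     subtraction and comparison, so that unit cost does not hide exponential
     work in huge numbers.
   - Elements of A can only be stored, loaded, added and multiplied, starting
     from 0_A and 1_A, at unit cost.
   - The vertices of G are numbered 0, ..., n - 1; G is accessed through n and
     through the tests "is x the label of (i, j)?".
   - Omega and W are arbitrary, so they are accessed through an oracle, which
     only gives the values that the pre-morphism axioms do not reduce to
     smaller ones: Omega_W({S -> {v}}) for a constant function S -> {v}.  The set S is
     written as a 0/1 vector of length n in an array, and a query is charged
     1 + n. *)
Section Syntax.
Variables X VH : finType.

Inductive iexp :=
| ICst of nat
| ISize
| IGet of nat & iexp                (* array name, index *)
| IAdd of iexp & iexp
| ISub of iexp & iexp
| IEq of iexp & iexp
| ILt of iexp & iexp
| IIsLab of X & iexp & iexp.

Inductive aexp :=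
| AZero
| AOne
| AGet of nat & iexp                (* array name, index *)
| AAdd of aexp & aexp
| AMul of aexp & aexp
| AOmega of nat & VH.               (* name of the array containing S, v *)

Inductive prog :=
| Skip
| SetI of nat & iexp & iexp         (* array name, index, value *)
| SetA of nat & iexp & aexp         (* array name, index, value *)
| Seq of prog & prog
| If of iexp & prog & prog
| While of iexp & prog.

Fixpoint icost (e : iexp) : nat :=
  match e with
  | ICst _ | ISize => 1
  | IGet _ e1 => (icost e1).+1
  | IAdd e1 e2 | ISub e1 e2 | IEq e1 e2 | ILt e1 e2 | IIsLab _ e1 e2 =>
      (icost e1 + icost e2).+1
  end.

Fixpoint acost (n : nat) (e : aexp) : nat :=
  match e with
  | AZero | AOne => 1
  | AGet _ e1 => (icost e1).+1
  | AAdd e1 e2 | AMul e1 e2 => (acost n e1 + acost n e2).+1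
  | AOmega _ _ => n.+1
  end.

End Syntax.

Definition set_cell (T : Type) (m : nat -> nat -> T) (a i : nat) (x : T) :
    nat -> nat -> T :=
  fun b j => if (b == a) && (j == i) then x else m b j.

Record state (A : Type) := State {
  imem : nat -> nat -> nat;         (* array name, index *)
  amem : nat -> nat -> A
}.

Definition init_state (A : pzSemiRingType) : state A :=
  State (fun _ _ => 0) (fun _ _ => 0%R).

Section Semantics.
Variables (A : pzSemiRingType) (B : Type) (Om : premorphism A B).
Variables (G H : elgraph) (nu : 'I_#|G| -> G) (W : G -> H -> B).
Implicit Types (s : state A).

Definition label_test (x : label G) (i j : nat) : bool :=
  match insub i, insub j with
  | Some i', Some j' => lab (nu i') (nu j') == x
  | _, _ => false
  end.

Fixpoint ieval s (e : iexp (label G)) : nat :=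
  match e with
  | ICst k => k
  | ISize => #|G|
  | IGet a e1 => imem s a (ieval s e1)
  | IAdd e1 e2 => ieval s e1 + ieval s e2
  | ISub e1 e2 => ieval s e1 - ieval s e2
  | IEq e1 e2 => ieval s e1 == ieval s e2
  | ILt e1 e2 => ieval s e1 < ieval s e2
  | IIsLab x e1 e2 => label_test x (ieval s e1) (ieval s e2)
  end.

Definition stored_set s (a : nat) : {set G} :=
  [set nu i | i : 'I_#|G| & imem s a i != 0].

Fixpoint aeval s (e : aexp (label G) H) : A :=
  match e with
  | AZero => 0%R
  | AOne => 1%R
  | AGet a e1 => amem s a (ieval s e1)
  | AAdd e1 e2 => (aeval s e1 + aeval s e2)%R
  | AMul e1 e2 => (aeval s e1 * aeval s e2)%R
  | AOmega a v =>
      let S := stored_set s a in omega Om S [set v] W [set const_pfun S v]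
  end.

(* [exec c s s' t]: started in state s, c halts in state s' after time t. *)
Inductive exec : prog (label G) H -> state A -> state A -> nat -> Prop :=
| ESkip s : exec (Skip _ _) s s 1
| ESetI s a e1 e2 :
    exec (SetI _ a e1 e2) s
      (State (set_cell (imem s) a (ieval s e1) (ieval s e2)) (amem s))
      (icost e1 + icost e2).+1
| ESetA s a e1 e2 :
    exec (SetA a e1 e2) s
      (State (imem s) (set_cell (amem s) a (ieval s e1) (aeval s e2)))
      (icost e1 + acost #|G| e2).+1
| ESeq c1 c2 s s1 s2 t1 t2 :
    exec c1 s s1 t1 -> exec c2 s1 s2 t2 -> exec (Seq c1 c2) s s2 (t1 + t2)
| EIfT e c1 c2 s s' t :
    ieval s e != 0 -> exec c1 s s' t ->
    exec (If e c1 c2) s s' (icost e + t).+1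
| EIfF e c1 c2 s s' t :
    ieval s e == 0 -> exec c2 s s' t ->
    exec (If e c1 c2) s s' (icost e + t).+1
| EWhileT e c s s1 s2 t1 t2 :
    ieval s e != 0 -> exec c s s1 t1 -> exec (While e c) s1 s2 t2 ->
    exec (While e c) s s2 (icost e + t1 + t2).+1
| EWhileF e c s :
    ieval s e == 0 -> exec (While e c) s s (icost e).+1.

Lemma exec_det c s s1 s2 t1 t2 :
  exec c s s1 t1 -> exec c s s2 t2 -> s1 = s2 /\ t1 = t2.
Proof.
move=> E; elim: E s2 t2 => {c s s1 t1}.
- by move=> s s2 t2 E; inversion E.
- by move=> s a e1 e2 s2 t2 E; inversion E.
- by move=> s a e1 e2 s2 t2 E; inversion E.
- move=> c1 c2 s s1 s2 t1 t2 _ IH1 _ IH2 s2' t2' E.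
  inversion E as [| | |? ? ? s3 ? t3 t4 E1 E2| | | |]; subst.
  have [? ?] := IH1 _ _ E1; subst s3 t3.
  by have [-> ->] := IH2 _ _ E2.
- move=> e c1 c2 s s' t h _ IH s2 t2 E; inversion E as
    [| | | |? ? ? ? ? t3 h' E1|? ? ? ? ? t3 h' E1| |]; subst.
    by have [-> ->] := IH _ _ E1.
  by rewrite h' in h.
- move=> e c1 c2 s s' t h _ IH s2 t2 E; inversion E as
    [| | | |? ? ? ? ? t3 h' E1|? ? ? ? ? t3 h' E1| |]; subst.
    by rewrite h in h'.
  by have [-> ->] := IH _ _ E1.
- move=> e c s s1 s2 t1 t2 h _ IH1 _ IH2 s3 t3 E; inversion E as
    [| | | | | |? ? ? s4 ? t4 t5 h' E1 E2|? ? ? h']; subst.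
    have [? ?] := IH1 _ _ E1; subst s4 t4.
    by have [-> ->] := IH2 _ _ E2.
  by rewrite h' in h.
- move=> e c s h s2 t2 E; inversion E as
    [| | | | | |? ? ? s4 ? t4 t5 h' E1 E2|? ? ? h']; subst => //.
  by rewrite h in h'.
Qed.

(* The output is read in cell 0 of array 0. *)
Definition outputs_in_time (c : prog (label G) H) (x : A) (T : nat) : Prop :=
  exists (s : state A) (t : nat),
    [/\ exec c (init_state A) s t, amem s 0 0 = x & t <= T].

End Semantics.

(* Main.v *)
Require Import Defs.
From HB Require Import structures.
From mathcomp Require Import all_boot all_order all_algebra.
From mathcomp Require Import zify.

Set Implicit Arguments.
Unset Strict Implicit.
Unset Printing Implicit Defensive.

(** For a set [C] of parts of a partition of [H] and a profile [f] mapping each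
    vertex of [G] to a part in [C] or to nothing, let the weight of [f] be the
    value of Omega on the partial morphisms sending each vertex of the domain of
    [f] into its part.  The tables of these weights are computed for all
    e-connected components [C] of all the contractions.

    When two parts are merged, a component [C] of the new contraction is the
    image of a set [C'] of at most [#|C| + 1] old parts, and [C'] is a union of
    old components.  The weight of a profile into [C] is the sum of the weights
    of its lifts to [C'].  The labels between two different old components are
    determined by the parts, so the weight of a lift is either 0, if a label
    between two of them violates [R], or the product of the weights of its
    restrictions to the old components.  Enumerating all partial maps from [G] to
    [C'] takes [(#|C'| + 1) ^ n <= (ctww H + 2) ^ n] iterations, each of cost
    [O(n ^ 2)].

    The weight of the empty profile is not determined by the axioms and depends
    on [C], hence there is one table per component. *)

(** * Digits and positional codes *)

Definition digit (q N i : nat) : nat := N %/ q ^ i %% q.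

Lemma digit0 q i : digit q 0 i = 0.
Proof. by rewrite /digit div0n mod0n. Qed.

(** The carry of an increment reaches position [i] exactly when [q ^ i] divides [N.+1], that is,
    when all lower digits of [N] equal [q - 1]. *)
Lemma digitS q N i : 1 < q ->
  digit q N.+1 i = (digit q N i + (q ^ i %| N.+1)) %% q.
Proof.
move=> q1; have q0 : 0 < q ^ i by rewrite expn_gt0 ltnW.
by rewrite /digit divnS // addnC modnDml.
Qed.

(** Carry propagation: a carry leaves position [i] when it has arrived there and meets the digit
    [q - 1]. *)
Lemma dvdn_digit q N i : 1 < q ->
  (q ^ i.+1 %| N.+1) = (q ^ i %| N.+1) && ((digit q N i).+1 == q).
Proof.
move=> q1; have q0 : 0 < q ^ i by rewrite expn_gt0 ltnW.
have [dvd|ndvd] := boolP (q ^ i %| N.+1); last first.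
  by apply/negP => /(dvdn_trans (dvdn_exp2l q (leqnSn i))); apply/negP.
have E : N.+1 = (N %/ q ^ i).+1 * q ^ i.
  by rewrite -{1}(divnK dvd) divnS // dvd add1n.
rewrite /= {1}E expnS dvdn_pmul2r // /digit.
set M := N %/ _; rewrite /dvdn -addn1 -modnDml addn1.
have := ltn_pmod M (ltnW q1); rewrite leq_eqVlt => /orP[/eqP->|h].
  by rewrite modnn !eqxx.
by rewrite modn_small // (ltn_eqF h).
Qed.

Lemma ltn_digit q N i : 0 < q -> digit q N i < q.
Proof. exact: ltn_pmod. Qed.

Lemma digit_inj q n N M : 0 < q -> N < q ^ n -> M < q ^ n ->
  (forall i, i < n -> digit q N i = digit q M i) -> N = M.
Proof.
move=> q0; elim: n N M => [|n IH] N M.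
  by rewrite expn0 !ltnS !leqn0 => /eqP-> /eqP->.
rewrite expnSr => hN hM h.
rewrite (divn_eq N q) (divn_eq M q); congr (_ * _ + _).
  apply: IH; rewrite ?ltn_divLR // => i i_n.
  by have := h i.+1 i_n; rewrite /digit expnS !divnMA.
by have := h 0 isT; rewrite /digit !divn1.
Qed.

(** Horner evaluation with [w 0] as leading digit: one pass over the word suffices, and each pass
    step only multiplies by the fixed number [d]. *)
Fixpoint horner_code (d : nat) (w : nat -> nat) (n : nat) : nat :=
  if n is m.+1 then d * horner_code d w m + w m else 0.

Lemma eq_horner_code d w1 w2 n : (forall i, i < n -> w1 i = w2 i) ->
  horner_code d w1 n = horner_code d w2 n.
Proof.
elim: n => //= n IH h; rewrite IH ?h // => i i_n.
by apply: h; apply: ltnW.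
Qed.

Lemma horner_code_inj d w1 w2 n :
  (forall i, i < n -> w1 i < d) -> (forall i, i < n -> w2 i < d) ->
  horner_code d w1 n = horner_code d w2 n -> forall i, i < n -> w1 i = w2 i.
Proof.
elim: n => // n IH h1 h2 /= E.
have l1 := h1 n (leqnn _); have l2 := h2 n (leqnn _).
have En : w1 n = w2 n.
  by have := congr1 (modn^~ d) E; rewrite !(mulnC d) !modnMDl !modn_small.
have Ec : horner_code d w1 n = horner_code d w2 n.
  have d0 : 0 < d by apply: leq_ltn_trans l1.
  by move: E; rewrite En => /addIn/eqP; rewrite eqn_pmul2l // => /eqP.
move=> i; rewrite ltnS leq_eqVlt => /orP[/eqP->//|].
by apply: IH => // j j_n; [apply: h1|apply: h2]; apply: ltnW.
Qed.

(** * Program fragments *)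

Section Fragments.
Variables X VH : finType.
Local Notation ie := (iexp X).
Local Notation pr := (prog X VH).

Definition ivar (a : nat) : ie := IGet a (ICst X 0).
Definition set_var (a : nat) (e : ie) : pr := SetI VH a (ICst X 0) e.

Definition For (v : nat) (e : ie) (body : pr) : pr :=
  Seq (set_var v (ICst X 0))
    (While (ILt (ivar v) e)
       (Seq body (set_var v (IAdd (ivar v) (ICst X 1))))).

(** The machine has no multiplication; a factor fixed in the program text is unrolled into
    additions, at a cost that does not depend on the instance. *)
Definition iscale (k : nat) (e : ie) : ie := iter k (IAdd e) (ICst X 0).

Definition isum (es : seq ie) : ie := foldr (@IAdd X) (ICst X 0) es.

(* [h k] if the value [k] of [e] is less than [q], and 0 otherwise. *)
Definition icase (q : nat) (h : nat -> nat) (e : ie) : ie :=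
  isum [seq iscale (h a) (IEq e (ICst X a)) | a <- iota 0 q].

(* Integer arrays: 0 holds the digits of the current vector, and cell 0 of the
   others holds 1: its rank, 2: the number of vectors, 3 and 4: inner loop
   counters, 5: a flag, 6: a positional code. *)
Definition cur_digit (v : nat) : ie := IGet 0 (ivar v).

(** A triple [(a, b, x)] forbids the digits [a] and [b] at the ends of an edge with label [x]. Three
    0/1 tests all hold when their sum is 3, and a disjunction is a nonzero sum. *)
Definition conflict_exp (bads : seq (nat * nat * X)) : ie :=
  isum [seq IEq (IAdd (IEq (cur_digit 3) (ICst X t.1.1))
                   (IAdd (IEq (cur_digit 4) (ICst X t.1.2))
                         (IIsLab t.2 (ivar 3) (ivar 4))))
               (ICst X 3) | t <- bads].

Definition check_prog (bads : seq (nat * nat * X)) : pr :=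
  Seq (set_var 5 (ICst X 1))
    (For 3 (ISize X) (For 4 (ISize X)
       (If (conflict_exp bads) (set_var 5 (ICst X 0)) (Skip X VH)))).

Definition code_exp (d q : nat) (h : nat -> nat) : ie :=
  IAdd (iscale d (ivar 6)) (icase q h (cur_digit 3)).

Definition code_prog (d q : nat) (h : nat -> nat) : pr :=
  Seq (set_var 6 (ICst X 0))
    (For 3 (ISize X) (set_var 6 (code_exp d q h))).

(** Increment of a [q]-ary counter whose least significant digit is at position 0; cell 0 of array 5
    is the carry, initially 1. *)
Definition next_prog (q : nat) : pr :=
  Seq (set_var 5 (ICst X 1))
    (For 3 (ISize X)
       (If (ivar 5)
          (If (IEq (IAdd (cur_digit 3) (ICst X 1)) (ICst X q))
             (SetI VH 0 (ivar 3) (ICst X 0))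
             (Seq (SetI VH 0 (ivar 3) (IAdd (cur_digit 3) (ICst X 1)))
                  (set_var 5 (ICst X 0))))
          (Skip X VH))).

Definition setup_prog (q : nat) : pr :=
  Seq (Seq (set_var 2 (ICst X 1))
         (For 3 (ISize X) (set_var 2 (iscale q (ivar 2)))))
      (For 3 (ISize X) (SetI VH 0 (ivar 3) (ICst X 0))).

Definition add_to (tgt : nat) : pr :=
  SetA tgt (ivar 6)
    (AAdd (AGet VH tgt (ivar 6)) (AGet VH 0 (ICst X 0))).

(* For each vector of [q]-ary digits without conflict, add the value left by
   [vp] in cell 0 of array 0 to the cell of array [tgt] with the code of the
   image of the vector under [h]. *)
Definition scatter_prog (d q : nat) (bads : seq (nat * nat * X))
    (h : nat -> nat) (vp : pr) (tgt : nat) : pr :=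
  Seq (setup_prog q)
    (For 1 (ivar 2)
       (Seq (check_prog bads)
       (Seq (If (ivar 5)
               (Seq vp (Seq (code_prog d q h) (add_to tgt)))
               (Skip X VH))
            (next_prog q)))).

End Fragments.

(** * Execution of the fragments *)

Section Runs.
Variables (A : pzSemiRingType) (B : Type) (Om : premorphism A B).
Variables (H : elgraph) (X V : finType) (l : V -> V -> X).
Let G : elgraph := ELGraph l.
Variables (nu : 'I_#|G| -> G) (W : G -> H -> B).
Hypotheses (G_gt0 : 0 < #|G|) (nu_bij : bijective nu).
Local Notation n := #|G|.
Local Notation ie := (iexp X).
Local Notation pr := (prog X H).
Local Notation ev := (@ieval A G nu).
Implicit Types (s : state A) (c : pr) (P Q : state A -> Prop).

(** A Hoare triple for total correctness with a time bound. A precondition [eq s0] lets the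
    postcondition refer to the initial state. *)
Definition runs c P (T : nat) Q : Prop :=
  forall s, P s -> exists s' t,
    [/\ @exec A B Om G H nu W c s s' t, t <= T & Q s'].

Definition put s (a i x : nat) : state A :=
  State (set_cell (imem s) a i x) (amem s).

Lemma runs_conseq c P P' T T' Q Q' :
  T <= T' -> (forall s, P' s -> P s) -> (forall s, Q s -> Q' s) ->
  runs c P T Q -> runs c P' T' Q'.
Proof.
move=> hT hP hQ h s /hP/h[s' [t [E ht q]]].
by exists s', t; split; [|apply: leq_trans hT|apply: hQ].
Qed.

Lemma runs_seq c1 c2 P Q Q' T1 T2 :
  runs c1 P T1 Q -> runs c2 Q T2 Q' -> runs (Seq c1 c2) P (T1 + T2) Q'.
Proof.
move=> h1 h2 s /h1[s1 [t1 [E1 l1 /h2[s2 [t2 [E2 l2 q]]]]]].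
by exists s2, (t1 + t2); split; [apply: ESeq E1 E2|apply: leq_add|].
Qed.

Lemma runs_if e c1 c2 P Q T :
  runs c1 (fun s => P s /\ ev s e != 0) T Q ->
  runs c2 (fun s => P s /\ ev s e = 0) T Q ->
  runs (If e c1 c2) P (icost e + T).+1 Q.
Proof.
move=> h1 h2 s p; have [e0|e0] := eqVneq (ev s e) 0.
  have [s' [t [E lt q]]] := h2 s (conj p e0).
  exists s', (icost e + t).+1; split => //; last by rewrite ltnS leq_add2l.
  by apply: EIfF E; rewrite e0.
have [s' [t [E lt q]]] := h1 s (conj p e0).
exists s', (icost e + t).+1; split => //; last by rewrite ltnS leq_add2l.
exact: EIfT E.
Qed.

Lemma runs_put a (e1 e2 : ie) P T Q :
  (icost e1 + icost e2).+1 <= T ->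
  (forall s, P s -> Q (put s a (ev s e1) (ev s e2))) ->
  runs (SetI H a e1 e2) P T Q.
Proof.
move=> hT h s /h q; exists (put s a (ev s e1) (ev s e2)); eexists.
by split; [apply: (ESetI Om nu W s a e1 e2)| |].
Qed.

Lemma runs_set_var a (e : ie) P Q :
  (forall s, P s -> Q (put s a 0 (ev s e))) ->
  runs (set_var H a e) P (icost e).+2 Q.
Proof. by move=> h; apply: runs_put. Qed.

(** The invariant must survive writes to the counter, and the body must leave the counter as it
    found it. As [M] is positive, the initialisation and the last test are absorbed into the cost of
    the iterations. *)
Lemma runs_for v (e : ie) c M b (I : nat -> state A -> Prop) :
  icost e <= 2 -> 0 < M ->
  (forall j s, I j s -> ev s e = M) ->
  (forall j s k, I j s -> I j (put s v 0 k)) ->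
  (forall j, j < M ->
     runs c (fun s => I j s /\ imem s v 0 = j) b
            (fun s => I j.+1 s /\ imem s v 0 = j)) ->
  runs (For v e c) (I 0) ((2 * b + 24) * M) (I M).
Proof.
move=> ce M0 hM hv hc.
(* Induction on the number [k] of remaining iterations: 12 pays for a test and an increment of the
   counter, 6 for the final failing test. *)
have loop : forall k j s, j + k = M -> I j s -> imem s v 0 = j ->
    exists s' t, [/\ @exec A B Om G H nu W (While (ILt (ivar X v) e)
       (Seq c (set_var H v (IAdd (ivar X v) (ICst X 1))))) s s' t,
       t <= (b + 12) * k + 6 & I M s'].
  elim=> [|k IH] j s jk Ij sj.
    exists s; eexists; split.
    - apply: EWhileF; rewrite /= sj (hM _ _ Ij) -jk addn0 ltnn //.
    - rewrite /=; lia.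
    - by move: Ij; rewrite -jk addn0.
  have jM : j < M by rewrite -jk -addSnnS leq_addr.
  have [s1 [t1 [E1 l1 [I1 s1j]]]] := hc j jM s (conj Ij sj).
  pose s2 := put s1 v 0 j.+1.
  have [||s' [t' [E' l' I']]] := IH j.+1 s2 _ (hv _ _ _ I1).
  - by rewrite addSnnS.
  - by rewrite /= /set_cell !eqxx.
  exists s'; eexists; split; last exact: I'.
    apply: EWhileT E'; first by rewrite /= sj (hM _ _ Ij) jM.
    apply: ESeq E1 _.
    have -> : s2 = put s1 v (ev s1 (ICst X 0))
       (ev s1 (IAdd (ivar X v) (ICst X 1))) by rewrite /s2 /= s1j addn1.
    exact: ESetI.
  rewrite /=; move: ce l1 l'; rewrite mulnS; lia.
move=> s I0.
have [||s' [t [E lt IM]]] := loop M 0 (put s v 0 0) (add0n M).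
- exact: hv.
- by rewrite /= /set_cell !eqxx.
exists s'; eexists; split; last exact: IM.
  by apply: ESeq E; apply: (ESetI Om nu W s v (ICst X 0) (ICst X 0)).
rewrite /=; move: lt; nia.
Qed.

Lemma ieval_iscale s k (e : ie) : ev s (iscale k e) = k * ev s e.
Proof. by elim: k => //= k ->; rewrite mulSn. Qed.

Lemma ieval_isum s (es : seq ie) : ev s (isum es) = \sum_(e <- es) ev s e.
Proof. by elim: es => [|e es IH]; rewrite ?big_nil ?big_cons //= IH. Qed.

Lemma ieval_icase s q h (e : ie) : ev s e < q -> ev s (icase q h e) = h (ev s e).
Proof.
move=> eq; rewrite ieval_isum big_map.
rewrite (bigD1_seq (ev s e)) ?mem_iota ?iota_uniq //= big1 ?addn0.
  by rewrite ieval_iscale /= eqxx muln1.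
by move=> a /negPf ae; rewrite ieval_iscale /= eq_sym ae muln0.
Qed.


(** Frame condition: [M] lists the integer arrays that may have been overwritten. *)
Definition keeps (M : seq nat) s0 s : Prop :=
  forall a k, a \notin M -> imem s a k = imem s0 a k.

Lemma keeps_put M s0 s a i x :
  a \in M -> keeps M s0 s -> keeps M s0 (put s a i x).
Proof.
move=> aM h b k bM; rewrite /= /set_cell h //.
by case: eqP => // ba; rewrite -ba (negPf bM) in aM.
Qed.

Lemma keeps_trans M M' s0 s1 s2 :
  {subset M <= M'} -> keeps M' s0 s1 -> keeps M s1 s2 -> keeps M' s0 s2.
Proof.
move=> sub h1 h2 a k aM; rewrite h2 ?h1 //.
by apply: contra aM; apply: sub.
Qed.

Lemma all_iotaS (p : pred nat) j :
  all p (iota 0 j.+1) = all p (iota 0 j) && p j.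
Proof. by rewrite -addn1 iotaD all_cat /= andbT add0n. Qed.

Definition conflict (bads : seq (nat * nat * X)) (x : nat -> nat) (i j : nat) :=
  has (fun t => [&& x i == t.1.1, x j == t.1.2 & @label_test G nu t.2 i j]) bads.

Definition conflict_free bads x : bool :=
  all (fun i => all (fun j => ~~ conflict bads x i j) (iota 0 n)) (iota 0 n).

Lemma ieval_conflict s bads :
  (ev s (conflict_exp bads) != 0) =
  conflict bads (imem s 0) (imem s 3 0) (imem s 4 0).
Proof.
rewrite /conflict_exp; elim: bads => //= t bads IH.
rewrite addn_eq0 negb_and IH; congr (_ || _).
by case: (_ == t.1.1); case: (_ == t.1.2); case: label_test.
Qed.

Lemma runs_check bads s0 :
  runs (check_prog H bads) (eq s0) ((4 * icost (conflict_exp bads) + 91) * n ^ 2)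
    (fun s => [/\ keeps [:: 3; 4; 5] s0 s, amem s = amem s0 &
                  imem s 5 0 = conflict_free bads (imem s0 0)]).
Proof.
set x := imem s0 0; set b := icost _.
pose J i s := [/\ keeps [:: 3; 4; 5] s0 s, amem s = amem s0 &
  imem s 5 0 = all (fun i => all (fun j => ~~ conflict bads x i j)
                                 (iota 0 n)) (iota 0 i)].
pose I i j s := [/\ keeps [:: 3; 4; 5] s0 s, amem s = amem s0, imem s 3 0 = i &
  imem s 5 0 = all (fun i => all (fun j => ~~ conflict bads x i j)
                                 (iota 0 n)) (iota 0 i) &&
               all (fun j => ~~ conflict bads x i j) (iota 0 j)].
(* With [n] positive, [3 + 24 n + (4 b + 64) n ^ 2] is at most [(4 b + 91) n ^ 2]. *)
apply: (@runs_conseq _ (eq s0) _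
          (3 + (2 * ((2 * (b + 4) + 24) * n) + 24) * n) _ (J n)) => //.
  by move: G_gt0; rewrite -mulnn; nia.
apply: (@runs_seq _ _ _ (J 0)).
  by apply: runs_set_var => _ <-; split=> //; apply: keeps_put.
apply: runs_for => // [j s k [h1 h2 h3]|i i_n].
  by split=> //; apply: keeps_put.
apply: (@runs_conseq _ (I i 0) _ ((2 * (b + 4) + 24) * n) _ (I i n)) => // [s [[h1 h2 h3] h4]|s [h1 h2 h3 h4]|].
- by split=> //; rewrite h3 andbT.
- by split=> //; split=> //; rewrite all_iotaS.
apply: (@runs_for _ _ _ _ _ (I i)) => // [j s k [h1 h2 h3 h4]|j j_n].
  by split=> //; apply: keeps_put.
apply: (@runs_conseq _ _ _ (b + 3).+1 _ _ _ _ (fun s p => p) (fun s p => p)).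
  by rewrite !addnS.
have cE s : I i j s -> imem s 4 0 = j ->
    (ev s (conflict_exp bads) != 0) = conflict bads x i j.
  move=> [h1 _ h3 _] h4; rewrite ieval_conflict h3 h4.
  by apply: eq_has => t; rewrite !h1.
apply: runs_if.
  apply: runs_set_var => s [[hI s4] e]; move: e; rewrite cE // => e.
  case: hI => h1 h2 h3 h4; split=> //; split=> //; first exact: keeps_put.
  by rewrite all_iotaS e !andbF.
move=> s [[hI s4] e]; exists s, 1; split=> //; first exact: ESkip.
case: (hI) => h1 h2 h3 h4; split=> //; split=> //.
by rewrite all_iotaS -(cE s) // e /= andbT.
Qed.

Lemma runs_code d q h s0 :
  (forall i, i < n -> imem s0 0 i < q) ->
  runs (code_prog X H d q h) (eq s0) ((2 * icost (code_exp X d q h) + 31) * n)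
    (fun s => [/\ keeps [:: 3; 6] s0 s, amem s = amem s0 &
                  imem s 6 0 = horner_code d (h \o imem s0 0) n]).
Proof.
move=> xq; set b := icost _; set x := imem s0 0.
pose J i s := [/\ keeps [:: 3; 6] s0 s, amem s = amem s0 &
                  imem s 6 0 = horner_code d (h \o x) i].
apply: (@runs_conseq _ (eq s0) _ (3 + (2 * b.+2 + 24) * n) _ (J n)) => //.
  by move: G_gt0; nia.
apply: (@runs_seq _ _ _ (J 0)).
  by apply: runs_set_var => _ <-; split=> //; apply: keeps_put.
apply: runs_for => // [j s k [h1 h2 h3]|i i_n].
  by split=> //; apply: keeps_put.
apply: runs_set_var => s [[h1 h2 h3] h4]; split=> //; split=> //.
  exact: keeps_put.
rewrite [LHS]/= ieval_iscale [X in _ + X]ieval_icase /=; first by rewrite h3 h4 h1.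
by rewrite h4 h1 // xq.
Qed.

Lemma runs_next q N s0 : 1 < q ->
  (forall i, i < n -> imem s0 0 i = digit q N i) ->
  runs (next_prog X H q) (eq s0) (87 * n)
    (fun s => [/\ keeps [:: 0; 3; 5] s0 s, amem s = amem s0 &
                  forall i, i < n -> imem s 0 i = digit q N.+1 i]).
Proof.
move=> q1 x0.
(* Before position [i] is treated, the flag is the carry into it, the positions below [i] hold
   digits of [N.+1] and the others still those of [N]. *)
pose J i s := [/\ keeps [:: 0; 3; 5] s0 s, amem s = amem s0,
   imem s 5 0 = (q ^ i %| N.+1) &
   forall j, j < n -> imem s 0 j = digit q (if j < i then N.+1 else N) j].
apply: (@runs_conseq _ (eq s0) _ (3 + (2 * 30 + 24) * n) _ (J n)) => //.
- by move: G_gt0; nia.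
- move=> s [h1 h2 h3 h4]; split=> // i i_n.
  by rewrite h4 // i_n.
apply: (@runs_seq _ _ _ (J 0)).
  apply: runs_set_var => _ <-; split=> //; first exact: keeps_put.
  by rewrite expn0 dvd1n.
apply: runs_for => // [j s k [h1 h2 h3 h4]|i i_n].
  by split=> //; apply: keeps_put.
(* The three branches of the body: overflow to 0, increment, and no carry. *)
have dS : (if (q ^ i %| N.+1) then if (digit q N i).+1 == q then 0
           else (digit q N i).+1 else digit q N i) = digit q N.+1 i.
  rewrite digitS //; case: (_ %| _); rewrite ?addn1 ?addn0; last first.
    by rewrite modn_small ?ltn_digit // ltnW.
  case: eqP => [->|/eqP e]; first by rewrite modnn.
  by rewrite modn_small // ltn_neqAle e ltn_digit // ltnW.
have stp j : (if j < i.+1 then N.+1 else N) =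
    (if j == i then N.+1 else if j < i then N.+1 else N).
  by rewrite ltnS leq_eqVlt; case: eqP.
have D := dvdn_digit N i q1.
apply: (@runs_conseq _ _ _ (2 + (8 + 13).+1).+1 _ _ _ _ (fun s p => p) (fun s p => p)) => //.
apply: runs_if; last first.
  move=> s [[[h1 h2 h3 h4] s3] /= s5]; exists s, 1; split=> //; first exact: ESkip.
  have E : (q ^ i %| N.+1) = false by apply/negP => E; rewrite h3 E in s5.
  split=> //; split=> //; first by rewrite D E s5.
  move=> j j_n; rewrite h4 // stp; case: eqP => // ->.
  by rewrite ltnn -dS E.
apply: runs_if.
  apply: runs_put => // s [[[[h1 h2 h3 h4] s3] /= s5] e].
  have E : (q ^ i %| N.+1) by apply: contraNT s5; rewrite h3 => /negPf->.
  have e' : (digit q N i).+1 == q.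
    by move: e; rewrite s3 h4 // ltnn addn1; case: (_ == q).
  split=> //=; split=> //.
  - exact: keeps_put.
  - by rewrite /= D E e' /set_cell /= h3 E.
  move=> j j_n; rewrite /= /set_cell /= s3 stp; case: eqP => [->|_]; last exact: h4.
  by rewrite -dS E e'.
apply: (@runs_conseq _ _ _ (10 + 3) _ _ _ _ (fun s p => p) (fun s p => p)) => //.
pose K s := [/\ keeps [:: 0; 3; 5] s0 s, amem s = amem s0, imem s 3 0 = i,
   (q ^ i.+1 %| N.+1) = false &
   forall j, j < n -> imem s 0 j = digit q (if j < i.+1 then N.+1 else N) j].
apply: (@runs_seq _ _ _ K); last first.
  apply: runs_set_var => s [h1 h2 h3 h4 h5]; split=> //; split=> //.
  - exact: keeps_put.
  - by rewrite h4 /=.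
apply: runs_put => // s [[[[h1 h2 h3 h4] s3] /= s5] e].
have E : (q ^ i %| N.+1) by apply: contraNT s5; rewrite h3 => /negPf->.
have e' : ((digit q N i).+1 == q) = false.
  by move: e; rewrite s3 h4 // ltnn addn1; case: (_ == q).
split=> //=.
- exact: keeps_put.
- by rewrite D E e'.
move=> j j_n; rewrite /= /set_cell /= s3 stp; case: eqP => [->|_]; last exact: h4.
by rewrite -dS E e' h4 // ltnn addn1.
Qed.

Lemma runs_setup q s0 :
  runs (setup_prog X H q) (eq s0) ((2 * icost (iscale q (ivar X 2)) + 63) * n)
    (fun s => [/\ amem s = amem s0, imem s 2 0 = q ^ n &
                  forall i, i < n -> imem s 0 i = 0]).
Proof.
set b := icost _.
pose J i s := amem s = amem s0 /\ imem s 2 0 = q ^ i.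
pose I i s := [/\ amem s = amem s0, imem s 2 0 = q ^ n &
                  forall j, j < i -> imem s 0 j = 0].
apply: (@runs_conseq _ (eq s0) _ (3 + (2 * b.+2 + 24) * n + (2 * 4 + 24) * n) _ (I n)) => //.
  by move: G_gt0; nia.
apply: (@runs_seq _ _ _ (I 0)).
  apply: (@runs_seq _ _ _ (J 0)).
    by apply: runs_set_var => _ <-; split.
  apply: (@runs_conseq _ (J 0) _ ((2 * b.+2 + 24) * n) _ (J n)) => // [s [h1 h2]//|].
  apply: runs_for => // i i_n.
  apply: runs_set_var => s [[h1 h2] h3]; split=> //; split=> //.
  by rewrite [LHS]/= ieval_iscale /= h2 expnS.
apply: runs_for => // i i_n.
apply: runs_put => // s [[h1 h2 h3] h4]; split=> //; split=> //.
move=> j; rewrite /= /set_cell /= h4; case: eqP => // ji; rewrite ltnS leq_eqVlt.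
by move/eqP/negPf: ji => -> /h3.
Qed.

(** * Vectors indexed by the vertices of [G], and their enumeration *)

Lemma insub_ord m i (i_m : i < m) : insub i = Some (Ordinal i_m) :> option 'I_m.
Proof. exact: insubT. Qed.

Definition vec (w : G -> nat) (i : nat) : nat :=
  if insub i is Some i' then w (nu i') else 0.

Lemma vecE w (i : 'I_n) : vec w i = w (nu i).
Proof. by rewrite /vec valK. Qed.

Lemma eq_conflict_free bads x y : (forall i, i < n -> x i = y i) ->
  conflict_free bads x = conflict_free bads y.
Proof.
move=> xy; apply: eq_in_all => i; rewrite mem_iota => i_n.
apply: eq_in_all => j; rewrite mem_iota => j_n.
by congr (~~ _); apply: eq_has => t; rewrite !xy.
Qed.

Lemma conflict_freeP bads w :
  reflect (forall u v, (w u, w v, l u v) \notin bads)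
          (conflict_free bads (vec w)).
Proof.
apply: (iffP allP) => [h u v|h i]; last first.
  rewrite mem_iota => i_n; apply/allP => j; rewrite mem_iota => j_n.
  apply/hasPn => -[[a b] x] t_in; apply/negP => /and3P[/= /eqP ea /eqP eb].
  rewrite /label_test (insub_ord (i_n : i < n)) (insub_ord (j_n : j < n)) => /eqP ex.
  move: (h (nu (Ordinal (i_n : i < n))) (nu (Ordinal (j_n : j < n)))).
  rewrite -!vecE /= ea eb; move: ex => /= ->; by rewrite t_in.
have [mu nuK muK] := nu_bij; apply/negP => t_in.
have := h (mu u); rewrite mem_iota => /(_ (ltn_ord _))/allP/(_ (val (mu v))).
rewrite mem_iota => /(_ (ltn_ord _))/hasPn/(_ _ t_in).
by rewrite /= !vecE /label_test !valK !muK !eqxx.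
Qed.

(** The counter meets every map from [G] to ['I_q] exactly once: the digits determine a number below
    [q ^ n], and there are [q ^ n] maps. *)
Lemma digit_vec q : 0 < q -> exists phi : 'I_(q ^ n) -> {ffun G -> 'I_q},
  bijective phi /\
  forall N i, i < n -> vec (fun u => phi N u) i = digit q N i.
Proof.
move=> q0; have [mu nuK muK] := nu_bij.
pose phi (N : 'I_(q ^ n)) := [ffun u : G => Ordinal (ltn_digit N (mu u) q0)].
exists phi.
have phiE (N : 'I_(q ^ n)) i : i < n -> vec (fun u => phi N u) i = digit q N i.
  by move=> i_n; rewrite (vecE _ (Ordinal i_n)) ffunE /= nuK.
split=> //; apply: inj_card_bij; last by rewrite card_ffun !card_ord.
move=> N M /ffunP E; apply: ord_inj; apply: (@digit_inj q n) => // i i_n.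
by rewrite -!phiE // !(vecE _ (Ordinal i_n)) E.
Qed.

(** The factor in front of [q ^ n * n ^ 2]; it is computed from the program text alone, so it is a
    constant for all instances. *)
Definition scatter_cost (d q : nat) (bads : seq (nat * nat * X))
    (h : nat -> nat) (b : nat) : nat :=
  2 * (4 * icost (conflict_exp bads) + 91 + b +
       (2 * icost (code_exp X d q h) + 31) + 99) + 24 +
  (2 * icost (iscale q (ivar X 2)) + 63).

Definition same_tables (ex : seq nat) s0 s : Prop :=
  forall a k, a \notin ex -> amem s a k = amem s0 a k.

(** Here [vf phi] is the value that [vp] must leave for the vector [phi]. It is only required for
    vectors without conflict, in states where every table other than cell array 0 and the target is
    as at the start. *)
Lemma runs_scatter d q bads h vp tgt b s0 (vf : {ffun G -> 'I_q} -> A) :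
  1 < q -> 0 < tgt ->
  (forall (phi : {ffun G -> 'I_q}) s1,
     (forall i, i < n -> imem s1 0 i = vec (fun u => phi u) i) ->
     same_tables [:: 0; tgt] s0 s1 ->
     conflict_free bads (vec (fun u => phi u)) ->
     runs vp (eq s1) (b * n)
       (fun s => [/\ keeps [:: 3; 6] s1 s, same_tables [:: 0] s1 s &
                     amem s 0 0 = vf phi])) ->
  runs (scatter_prog d q bads h vp tgt) (eq s0)
    (scatter_cost d q bads h b * (q ^ n * n ^ 2))
    (fun s => same_tables [:: 0; tgt] s0 s /\
      forall k, amem s tgt k = (amem s0 tgt k +
        \sum_(phi : {ffun G -> 'I_q} |
               conflict_free bads (vec (fun u => phi u)) &&
               (horner_code d (h \o vec (fun u => phi u)) n == k)) vf phi)%R).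
Proof.
move=> q1 tgt0 hvp; have q0 := ltnW q1.
have [phi [phi_bij phiE]] := digit_vec q0.
pose cond (f : {ffun G -> 'I_q}) k := conflict_free bads (vec (fun u => f u)) &&
               (horner_code d (h \o vec (fun u => f u)) n == k).
pose F N k : A := (if insub N is Some N' then
  if cond (phi N') k then vf (phi N') else 0 else 0)%R.
(* After [N] rounds the digits spell [N], and cell [k] of the target has received the contributions
   [F i k] of the first [N] vectors. *)
pose I N s := [/\ forall i, i < n -> imem s 0 i = digit q N i,
   imem s 2 0 = q ^ n, same_tables [:: 0; tgt] s0 s &
   forall k, amem s tgt k = (amem s0 tgt k + \sum_(0 <= i < N) F i k)%R].
set c1 := 4 * icost (conflict_exp bads) + 91.
set c2 := 2 * icost (code_exp X d q h) + 31.
set c3 := 2 * icost (iscale q (ivar X 2)) + 63.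
have qn0 : 0 < q ^ n by rewrite expn_gt0 q0.
apply: (@runs_conseq _ (eq s0) _
          (c3 * n + (2 * ((c1 + b + c2 + 99) * n ^ 2) + 24) * (q ^ n)) _ (I (q ^ n))) => //.
(* The linear set-up cost and the constant overhead per round are absorbed, since [q ^ n] and
   [n ^ 2] are positive. *)
- rewrite /scatter_cost -/c1 -/c2 -/c3; move: G_gt0 qn0; rewrite -mulnn.
  set C := c1 + b + c2 + 99; move: (q ^ n) => Q; move: #|G| => m m0 Q0.
  have -> : (2 * (C * (m * m)) + 24) * Q = 2 * C * (Q * (m * m)) + 24 * Q by nia.
  have mm0 : 0 < m * m by rewrite muln_gt0 m0.
  have h1 : Q <= Q * (m * m) by rewrite leq_pmulr.
  have h2 : m <= Q * (m * m).
    by rewrite mulnA (leq_trans (leq_pmulr m Q0)) // mulnC leq_pmulr.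
  have := leq_mul (leqnn c3) h2; rewrite !mulnDl; lia.
- move=> s [_ _ h1 h2]; split=> // k; rewrite h2; congr (_ + _)%R.
  rewrite big_mkord (reindex phi); last exact: onW_bij.
  rewrite [RHS]big_mkcond; apply: eq_bigr => N _.
  by rewrite /F valK.
apply: (@runs_seq _ _ _ (I 0)).
  apply: (runs_conseq _ _ _ (@runs_setup q s0)) => // s [h1 h2 h3]; split=> //.
  - by move=> i i_n; rewrite h3 // digit0.
  - by move=> a k _; rewrite h1.
  - by move=> k; rewrite h1 big_geq // GRing.addr0.
apply: runs_for => // [j s []//|N N_lt s [[x_s s2 s_off s_tgt] s1]].
have [sa [ta [Ea la [ka aa fa]]]] := runs_check bads (erefl s).
pose f := phi (Ordinal N_lt).
have xf i : i < n -> imem s 0 i = vec (fun u => f u) i.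
  by move=> i_n; rewrite x_s // phiE.
rewrite (eq_conflict_free _ xf) in fa.
have FN k : F N k = (if cond f k then vf f else 0)%R by rewrite /F (insub_ord N_lt).
(* Both outcomes of the conflict test lead to the sum of the first [N.+1] contributions, a vector
   with a conflict contributing 0. *)
have [sb [tb [Eb lb [xb b2 b1 [b_off b_tgt]]]]] : exists sb tb,
  [/\ @exec A B Om G H nu W (If (ivar X 5)
               (Seq vp (Seq (code_prog X H d q h) (add_to X H tgt)))
               (Skip X H)) sa sb tb, tb <= (b + c2) * n + 12 &
  [/\ forall i, i < n -> imem sb 0 i = digit q N i,
      imem sb 2 0 = q ^ n, imem sb 1 0 = N &
      same_tables [:: 0; tgt] s0 sb /\
      forall k, amem sb tgt k = (amem s0 tgt k + \sum_(0 <= i < N.+1) F i k)%R]].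
  have [cf|cf] := boolP (conflict_free bads (vec (fun u => f u))); last first.
    exists sa; eexists; split.
    - by apply: EIfF; [rewrite /= fa (negPf cf)|apply: ESkip].
    - by rewrite /=; lia.
    split; rewrite ?ka // ?aa //.
    - by move=> i i_n; rewrite ka // x_s.
    - split=> [a k ex|k]; rewrite ?aa; first by apply: s_off.
      rewrite big_nat_recr //= s_tgt FN.
      by rewrite /cond (negPf cf) GRing.addr0.
  have [i i_n||sv [tv [Ev lv [kv av vv]]]] := hvp f sa _ _ cf _ (erefl sa).
  - by rewrite ka // xf.
  - by move=> a k ex; rewrite aa; apply: s_off.
  have xv i : i < n -> imem sv 0 i = vec (fun u => f u) i.
    by move=> i_n; rewrite kv // ka // xf.
  have [|sc [tc [Ec lc [kc ac cc]]]] := @runs_code d q h sv _ _ (erefl sv).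
    by move=> i i_n; rewrite xv // (vecE _ (Ordinal i_n)).
  exists (State (imem sc) (set_cell (amem sc) tgt (imem sc 6 0)
    (amem sc tgt (imem sc 6 0) + amem sc 0 0)%R)); eexists; split.
  - apply: EIfT; first by rewrite /= fa cf.
    apply: ESeq Ev _; apply: ESeq Ec _.
    exact: (ESetA Om nu W sc tgt (ivar X 6)
      (AAdd (AGet H tgt (ivar X 6)) (AGet H 0 (ICst X 0)))).
  - by move: lv lc; rewrite /= -/c2; lia.
  split.
  - by move=> i i_n; rewrite /= kc // kv // ka // x_s.
  - by rewrite /= kc // kv // ka.
  - by rewrite /= kc // kv // ka.
  have tgtN0 : tgt \notin [:: 0] by rewrite inE -lt0n.
  split=> [a k ex|k]; rewrite /= /set_cell.
    move: (ex); rewrite !inE negb_or => /andP[a0 /negPf->] /=.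
    by rewrite ac av ?inE // aa s_off.
  rewrite eqxx /= ac big_nat_recr //= FN.
  have -> : cond f k = (imem sc 6 0 == k).
    rewrite /cond cf cc /=; congr (_ == k).
    by apply: eq_horner_code => i i_n; rewrite /= xv.
  rewrite eq_sym; case: eqP => [<-|_].
    by rewrite vv av // aa s_tgt GRing.addrA.
  by rewrite av // aa s_tgt GRing.addr0.
have [|sn [tn [En ln [kn an xn]]]] := @runs_next q N sb q1 _ _ (erefl sb).
  exact: xb.
exists sn; eexists; split.
- by apply: ESeq Ea _; apply: ESeq Eb En.
- move: la lb ln; rewrite -/c1 -mulnn; move: G_gt0; nia.
split; last by rewrite kn.
by split=> // [|a k ex|k]; rewrite ?kn ?an //; apply: b_off.
Qed.

End Runs.

(** * Profiles *)

Section Profiles.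
Variables (A : pzSemiRingType) (B : Type) (Om : premorphism A B).
Variables (H : elgraph) (X V : finType) (R : {set X * label H}).
Variable l : V -> V -> X.
Let G : elgraph := ELGraph l.
Variable W : G -> H -> B.
Implicit Types (C D : {set {set H}}) (g : pfun G H).

Definition profile := {ffun G -> option {set H}}.
Implicit Types f : profile.

Definition pdom f : {set G} := [set u | f u != None].

Definition follows f g : bool :=
  [forall u, match f u, g u with
             | Some Y, Some v => v \in Y
             | None, None => true
             | _, _ => false
             end].

Definition partial_morphism g : bool :=
  [forall u : G, forall v : G,
     if g u is Some a then
       if g v is Some b then (l u v, lab a b) \in R else true
     else true].

Definition compat f : {set pfun G H} :=
  [set g | follows f g && partial_morphism g].

Definition into C f : bool :=
  [forall u, if f u is Some Y then Y \in C else true].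

(** The codomain is everything covered by [C], including parts that [f] does not take as values. *)
Definition weight C f : A := omega Om (pdom f) (cover C) W (compat f).

Definition restrict C f : profile :=
  [ffun u => if f u is Some Y then if Y \in C then Some Y else None else None].

Lemma intoP C f u S : into C f -> f u = Some S -> S \in C.
Proof. by move=> /forallP/(_ u); case: (f u) => // T h [<-]. Qed.

Lemma follows_some f g u v :
  follows f g -> g u = Some v -> exists2 S, f u = Some S & v \in S.
Proof.
by move=> /forallP/(_ u) + E; rewrite E; case: (f u) => // S vS; exists S.
Qed.

Lemma follows_none f g u : follows f g -> g u = None -> f u = None.
Proof. by move=> /forallP/(_ u) + E; rewrite E; case: (f u). Qed.

Lemma partial_morphismP g u v a b :
  partial_morphism g -> g u = Some a -> g v = Some b -> (l u v, lab a b) \in R.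
Proof. by move=> /forallP/(_ u)/forallP/(_ v) + Eu Ev; rewrite Eu Ev. Qed.

Lemma compat_functions C f :
  into C f -> compat f \subset functions (pdom f) (cover C).
Proof.
move=> fC; apply/subsetP => g; rewrite !inE => /andP[fg _].
apply/forallP => u; rewrite inE; move/forallP: fg => /(_ u).
case Ef: (f u) => [S|] /=; case: (g u) => // v vS.
by apply/bigcupP; exists S => //; apply: intoP Ef.
Qed.

(** Finite additivity over the fibres of [key], by induction on a duplicate-free list of keys: the
    fibre of a new key is disjoint from the earlier ones. *)
Lemma omega_sum (S : {set G}) (T : {set H}) (K : finType)
    (key : pfun G H -> K) (F : {set pfun G H}) : F \subset functions S T ->
  omega Om S T W F = (\sum_k omega Om S T W [set g in F | key g == k])%R.
Proof.
move=> FS.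
have sub (p : pred (pfun G H)) : [set g in F | p g] \subset functions S T.
  by apply: subset_trans FS; apply/subsetP => g; rewrite inE => /andP[].
have aux (r : seq K) : uniq r ->
    omega Om S T W [set g in F | key g \in r] =
    (\sum_(k <- r) omega Om S T W [set g in F | key g == k])%R.
  elim: r => [_|k r IH /= /andP[kr ur]].
    rewrite big_nil -[RHS](omega0 Om S T W); congr omega.
    by apply/setP => g; rewrite !inE andbF.
  rewrite big_cons -IH // -omegaU //.
    congr omega; apply/setP => g; rewrite !inE.
    by case: (g \in F).
  apply/pred0P => g; rewrite /= !inE; apply/negbTE/negP.
  by case/andP=> /andP[_ /eqP->] /andP[_]; apply/negP.
rewrite -aux ?index_enum_uniq //; congr omega; apply/setP => g.
by rewrite !inE mem_index_enum andbT.
Qed.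

Lemma into_restrict C f : into C (restrict C f).
Proof.
apply/forallP => u; rewrite ffunE; case: (f u) => // S.
by case: ifP.
Qed.

Lemma restrict_id C f : into C f -> restrict C f = f.
Proof.
move=> fC; apply/ffunP => u; rewrite ffunE; case E: (f u) => [S|] //.
by rewrite (intoP fC E).
Qed.

Lemma restrict_restrict C D f :
  C \subset D -> restrict C (restrict D f) = restrict C f.
Proof.
move=> CD; apply/ffunP => u; rewrite !ffunE; case: (f u) => // S.
by case: ifP => //; case: ifP => // /(subsetP CD) ->.
Qed.

(** * Multiplicativity of weights over disjoint sets of parts *)

Definition respects (u v : G) (S T : {set H}) : bool :=
  [forall a in S, forall b in T, (l u v, lab a b) \in R].

Lemma disjoint_cover P C D : partition P [set: H] ->
  C \subset P -> D \subset P -> [disjoint C & D] ->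
  [disjoint cover C & cover D].
Proof.
move=> /and3P[_ /trivIsetP tP _] CP DP CD; apply/pred0P => v /=.
apply/negP => /andP[/bigcupP[S SC vS] /bigcupP[T TD vT]].
have ST : S != T.
  apply/eqP => E; move/pred0P: CD => /(_ S) /=.
  by rewrite SC E TD.
have /pred0P/(_ v) := tP _ _ (subsetP CP _ SC) (subsetP DP _ TD) ST.
by rewrite /= vS vT.
Qed.

(** Neither restriction checks the pairs with one vertex sent into [C] and the other into [D]. For
    these, [respects] gives the morphism condition whatever images are chosen inside the parts, so
    the two sides may be chosen independently. *)
Lemma compat_join C D f : [disjoint C & D] -> into (C :|: D) f ->
  (forall u v S T, f u = Some S -> f v = Some T ->
     (S \in C) && (T \in D) || (S \in D) && (T \in C) -> respects u v S T) ->
  compat f = fjoins (compat (restrict C f)) (compat (restrict D f)).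
Proof.
move=> CD fCD ok; have dis S : S \in C -> S \in D -> False.
  by move=> SC SD; move/pred0P: CD => /(_ S) /=; rewrite SC SD.
apply/setP => g; apply/idP/imset2P => [|[g1 g2]].
  rewrite inE => /andP[fg mg].
  pose gr E : pfun G H := [ffun u => if restrict E f u is Some _ then g u else None].
  have gr_in E : gr E \in compat (restrict E f).
    rewrite inE; apply/andP; split.
      apply/forallP => u; rewrite !ffunE.
      move/forallP: fg => /(_ u).
      by case: (f u) => // S; case: ifP => // _; case: (g u).
    apply/forallP => u; apply/forallP => v; rewrite /gr !ffunE.
    case: (f u) => // S; case: ifP => // _; case Eu: (g u) => [a|] //.
    case: (f v) => // T; case: ifP => // _; case Ev: (g v) => [b|] //.
    exact: partial_morphismP Eu Ev.
  exists (gr C) (gr D) => //; apply/ffunP => u; rewrite !ffunE.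
  case Ef: (f u) => [S|]; last first.
    by move/forallP: fg => /(_ u); rewrite Ef; case: (g u).
  have := intoP fCD Ef; rewrite inE; case: ifP => [_ _|_ /= ->] //.
  by case Eg: (g u) => [a|] //; case: ifP => // _; move/forallP: fg => /(_ u);
    rewrite Ef Eg.
rewrite !inE => /andP[f1 m1] /andP[f2 m2] ->{g}.
(* Each value of the join comes from one side, together with the part of [f] on that side which
   contains it. *)
have cases u a : fjoin g1 g2 u = Some a ->
   (g1 u = Some a /\ exists S, [/\ f u = Some S, S \in C & a \in S]) \/
   (g2 u = Some a /\ exists S, [/\ f u = Some S, S \in D & a \in S]).
  rewrite ffunE; case E1: (g1 u) => [a'|].
    case=> aa; left; rewrite -aa; split=> //.
    have [S] := follows_some f1 E1; rewrite ffunE.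
    case: (f u) => // S'; case: ifP => // SC [<-] aS.
    by exists S'.
  move=> E2; right; split=> //.
  have [S] := follows_some f2 E2; rewrite ffunE.
  by case: (f u) => // S'; case: ifP => // SC [<-] aS; exists S'.
apply/andP; split.
  apply/forallP => u; case Eg: (fjoin g1 g2 u) => [a|].
    by case: (cases _ _ Eg) => -[_ [S [-> _ ->]]].
  move: Eg; rewrite ffunE; case E1: (g1 u) => // E2.
  have := follows_none f1 E1; have := follows_none f2 E2; rewrite !ffunE.
  case Ef: (f u) => [S|] //; have := intoP fCD Ef; rewrite inE.
  by case: ifP => // _; case: ifP.
apply/forallP => u; apply/forallP => v.
case Eu: (fjoin g1 g2 u) => [a|] //; case Ev: (fjoin g1 g2 v) => [b|] //.
have resp S T : respects u v S T -> a \in S -> b \in T -> (l u v, lab a b) \in R.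
  by move=> /forall_inP h aS bT; move/forall_inP: (h a aS) => /(_ b bT).
case: (cases _ _ Eu) (cases _ _ Ev) => -[e1 [S [fu SC aS]]] [] [e2 [T [fv TC bT]]].
- exact: partial_morphismP e1 e2.
- by apply: (resp S T) => //; apply: ok; rewrite ?SC ?TC.
- by apply: (resp S T) => //; apply: ok; rewrite ?SC ?TC ?orbT.
- exact: partial_morphismP e1 e2.
Qed.

Lemma cover_setU C D : cover (C :|: D) = cover C :|: cover D.
Proof. by rewrite /cover bigcup_setU. Qed.

Lemma pdom_join C D f : into (C :|: D) f ->
  pdom f = pdom (restrict C f) :|: pdom (restrict D f).
Proof.
move=> fCD; apply/setP => u; rewrite !inE !ffunE.
case Ef: (f u) => [S|] //; have := intoP fCD Ef; rewrite inE.
by case: (S \in C); case: (S \in D).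
Qed.

Lemma disjoint_pdom C D f : [disjoint C & D] ->
  [disjoint pdom (restrict C f) & pdom (restrict D f)].
Proof.
move=> CD; apply/pred0P => u; rewrite /= !inE !ffunE; case: (f u) => // S.
by move/pred0P: CD => /(_ S) /=; case: (S \in C); case: (S \in D).
Qed.

Lemma weight_join P C D f : partition P [set: H] ->
  C \subset P -> D \subset P -> [disjoint C & D] -> into (C :|: D) f ->
  (forall u v S T, f u = Some S -> f v = Some T ->
     (S \in C) && (T \in D) || (S \in D) && (T \in C) -> respects u v S T) ->
  weight (C :|: D) f = (weight C (restrict C f) * weight D (restrict D f))%R.
Proof.
move=> pP CP DP CD fCD ok.
rewrite /weight (compat_join CD fCD ok) (pdom_join fCD) cover_setU.
apply: omega_join; rewrite ?compat_functions ?into_restrict //.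
  exact: disjoint_pdom.
exact: disjoint_cover pP CP DP CD.
Qed.

Definition unions (Ds : seq {set {set H}}) := \bigcup_(D <- Ds) D.

Lemma mem_unions Ds S : (S \in unions Ds) = has (fun D => S \in D) Ds.
Proof.
rewrite /unions; elim: Ds => [|D Ds IH]; first by rewrite big_nil inE.
by rewrite big_cons inE IH.
Qed.

(** Iterates [weight_join]. The axioms do not force the weight over no parts to be 1, so [Ds] is
    nonempty and the induction starts from a one-element list. *)
Lemma weight_prod P Ds f : partition P [set: H] -> Ds != [::] ->
  unions Ds \subset P -> pairwise (fun C D => [disjoint C & D]) Ds ->
  into (unions Ds) f ->
  (forall u v S T, f u = Some S -> f v = Some T ->
     ~~ has (fun D => (S \in D) && (T \in D)) Ds -> respects u v S T) ->
  weight (unions Ds) f = (\prod_(D <- Ds) weight D (restrict D f))%R.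
Proof.
move=> pP; elim: Ds f => // D Ds IH f _.
have [->|Ds0] := eqVneq Ds [::].
  rewrite /unions !big_seq1 => _ _ fD _.
  by rewrite restrict_id.
have -> : unions (D :: Ds) = D :|: unions Ds by rewrite /unions big_cons.
rewrite subUset => /andP[DP DsP] /= /andP[dD dDs] fU ok.
have disj : [disjoint D & unions Ds].
  apply/pred0P => S; rewrite /= mem_unions; apply/negP => /andP[SD /hasP[E EDs SE]].
  by move/allP: dD => /(_ E EDs)/pred0P/(_ S); rewrite /= SD SE.
have nD S E : S \in D -> E \in Ds -> S \in E -> False.
  by move=> SD EDs SE; move/allP: dD => /(_ E EDs)/pred0P/(_ S); rewrite /= SD SE.
rewrite (weight_join pP) // => [|u v S T fu fv c].
  rewrite big_cons IH //; last first.
  - move=> u v S T; rewrite !ffunE.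
    case fu: (f u) => [S'|] //; case: ifP => // SU [<-].
    case fv: (f v) => [T'|] //; case: ifP => // TU [<-] h.
    apply: ok => //; rewrite negb_or h andbT; apply/negP => /andP[SD _].
    by move: SU; rewrite mem_unions => /hasP[E]; apply: nD.
  - exact: into_restrict.
  congr (_ * _)%R; apply: eq_big_seq => E EDs; rewrite restrict_restrict //.
  by apply/subsetP => S SE; rewrite mem_unions; apply/hasP; exists E.
apply: ok => //; rewrite negb_or; apply/andP; split.
  apply/negP => /andP[SD TD].
  case/orP: c => /andP[]; rewrite mem_unions.
    by move=> _ /hasP[E EDs TE]; apply: nD TD EDs TE.
  by move=> /hasP[E EDs SE] _; apply: nD SD EDs SE.
apply/hasPn => E EDs; apply/negP => /andP[SE TE].
by case/orP: c => /andP[h h']; [apply: (nD S E)|apply: (nD T E)].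
Qed.

(* A merge of parts is given by [pi], mapping each part of [P] to the part of
   [Q] containing it. *)
Section Lift.
Variables (P Q C : {set {set H}}) (pi : {set H} -> {set H}).
Hypotheses (pP : partition P [set: H]) (pQ : partition Q [set: H]).
Hypotheses (piP : forall S, S \in P -> pi S \in Q /\ S \subset pi S).
Hypothesis CQ : C \subset Q.

Definition preparts : {set {set H}} := [set S in P | pi S \in C].

(** Digit 0 stands for a vertex outside the domain and digit [a.+1] for the part of index [a]; hence
    the base [#|preparts|.+1]. *)
Definition part_of (a : nat) : option {set H} :=
  nth None (None :: map Some (enum preparts)) a.

Definition profile_of (phi : {ffun G -> 'I_#|preparts|.+1}) : profile :=
  [ffun u => part_of (phi u)].

Definition pushforward f : profile := [ffun u => omap pi (f u)].

Lemma part_of_in a S : part_of a = Some S -> S \in preparts.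
Proof.
case: a => [|a] //; rewrite /part_of /= => E; rewrite -mem_enum.
have a_lt : a < size (map Some (enum preparts)).
  by rewrite ltnNge; apply/negP => h; rewrite nth_default in E.
have := mem_nth None a_lt; rewrite E => /mapP[T]; rewrite mem_enum => ? [->].
by rewrite mem_enum.
Qed.

Lemma part_of_index S : S \in preparts ->
  part_of (index S (enum preparts)).+1 = Some S.
Proof.
move=> SC; rewrite /part_of /= (nth_map set0) ?nth_index ?mem_enum //.
by rewrite index_mem mem_enum.
Qed.

Lemma part_of_inj a b : a < #|preparts|.+1 -> b < #|preparts|.+1 ->
  part_of a = part_of b -> a = b.
Proof.
have sz : size (map Some (enum preparts)) = #|preparts|.
  by rewrite size_map -cardE.
have un : uniq (None :: map Some (enum preparts)).
  rewrite /= map_inj_uniq ?enum_uniq ?andbT; last by move=> ? ? [].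
  by apply/mapP => -[].
move=> ha hb; rewrite /part_of => /eqP; rewrite nth_uniq /= ?sz //.
by move/eqP.
Qed.

Lemma into_profile_of phi : into preparts (profile_of phi).
Proof.
apply/forallP => u; rewrite ffunE; case E: part_of => [S|] //.
exact: part_of_in E.
Qed.

Lemma pblock_part S v : S \in P -> v \in S -> pblock P v = S.
Proof. by case/and3P: pP => _ tP _; apply: def_pblock. Qed.

Lemma part_pblock (v : H) : pblock P v \in P /\ v \in pblock P v.
Proof.
have vP : v \in cover P by rewrite (cover_partition pP) inE.
by rewrite pblock_mem // mem_pblock.
Qed.

Lemma pi_pblock S v : S \in Q -> v \in S -> pi (pblock P v) = S.
Proof.
case/and3P: pQ => _ tQ _ SQ vS; have [bP vb] := part_pblock v.
have [piQ /subsetP sub] := piP bP.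
by rewrite -(def_pblock tQ piQ (sub _ vb)) (def_pblock tQ SQ vS).
Qed.

Lemma cover_preparts : cover preparts = cover C.
Proof.
apply/setP => v; apply/bigcupP/bigcupP => -[S SC vS].
  move: SC; rewrite inE => /andP[SP SC]; exists (pi S) => //.
  by have [_ /subsetP] := piP SP; apply.
have [bP vb] := part_pblock v.
exists (pblock P v) => //; rewrite inE bP /=.
by rewrite (pi_pblock (subsetP CQ _ SC) vS).
Qed.

(** The only lift that [g] can follow: each vertex goes to the old part containing its image. *)
Definition lift_key g : {ffun G -> 'I_#|preparts|.+1} :=
  [ffun u => inord (if g u is Some v then (index (pblock P v) (enum preparts)).+1
                    else 0)].

Lemma lift_keyE g f u v : into C f -> follows f g -> g u = Some v ->
  part_of (lift_key g u) = Some (pblock P v) /\ pblock P v \in preparts.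
Proof.
move=> fC fg gu; have [S fu vS] := follows_some fg gu.
have SC := intoP fC fu; have [bP vb] := part_pblock v.
have bC : pblock P v \in preparts.
  by rewrite inE bP (pi_pblock (subsetP CQ _ SC) vS).
split=> //; rewrite ffunE gu inordK ?part_of_index //.
by rewrite ltnS cardE index_mem mem_enum.
Qed.

(** Old parts are disjoint and refine the new ones, so a map compatible with [f] follows exactly one
    profile into old parts, and the pushforward of that profile is [f]. *)
Lemma compat_key f phi : into C f ->
  [set g in compat f | lift_key g == phi] =
  if pushforward (profile_of phi) == f then compat (profile_of phi) else set0.
Proof.
move=> fC; apply/setP => g.
transitivity ((pushforward (profile_of phi) == f) && (g \in compat (profile_of phi)));
  last by case: ifP => // _; rewrite in_set0.
rewrite !inE.
case: (partial_morphism g); rewrite ?andbT ?andbF //.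
apply/andP/andP => -[].
  move=> fg /eqP<-; split.
    apply/eqP/ffunP => u; rewrite !ffunE; case gu: (g u) => [v|].
      have [e bC] := lift_keyE fC fg gu.
      rewrite ffunE gu in e; rewrite e /=.
      have [S fu vS] := follows_some fg gu.
      by rewrite fu (pi_pblock _ vS) // (subsetP CQ) // (intoP fC fu).
    by rewrite inordK // (follows_none fg gu).
  apply/forallP => u; rewrite ffunE; case gu: (g u) => [v|].
    have [-> _] := lift_keyE fC fg gu.
    have [_ vb] := part_pblock v; exact: vb.
  by rewrite ffunE gu inordK.
move=> /eqP fE fg.
have sub S : S \in preparts -> S \subset pi S.
  by rewrite inE => /andP[/piP[]].
split.
  apply/forallP => u; rewrite -fE !ffunE; move/forallP: fg => /(_ u).
  rewrite ffunE; case E: part_of => [S|] //=; case: (g u) => // v.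
  by apply/subsetP/sub; apply: part_of_in E.
apply/eqP/ffunP => u; apply: ord_inj; apply: part_of_inj => //.
rewrite ffunE; move/forallP: fg => /(_ u); rewrite ffunE.
case E: part_of => [S|]; last by case: (g u) => // _; rewrite inordK.
case: (g u) => // v vS.
have SC := part_of_in E; have SP : S \in P by move: SC; rewrite inE => /andP[].
rewrite (pblock_part SP vS) inordK ?part_of_index //.
by rewrite ltnS cardE index_mem mem_enum.
Qed.

Lemma pdom_pushforward f : pdom (pushforward f) = pdom f.
Proof. by apply/setP => u; rewrite !inE ffunE; case: (f u). Qed.

(** Additivity over the fibres of [lift_key]. A lift has the same domain as [f], and the old parts
    cover the same vertices as [C], so all terms use the same domain and codomain. *)
Lemma weight_lift f : into C f ->
  weight C f = (\sum_(phi | pushforward (profile_of phi) == f)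
                  weight preparts (profile_of phi))%R.
Proof.
move=> fC; rewrite /weight (omega_sum lift_key (compat_functions fC)).
rewrite [RHS]big_mkcond; apply: eq_bigr => phi _; rewrite compat_key //.
case: eqP => [<-|_]; last exact: omega0.
by rewrite pdom_pushforward cover_preparts.
Qed.

End Lift.

End Profiles.

(** * Components of a partition *)

Section Components.
Variable H : elgraph.
Implicit Types (P Q C D : {set {set H}}) (S T : {set H}).

Definition uniform S T : bool :=
  [exists x, forall u in S, forall v in T, lab u v == x].

(** The e-adjacency of the contraction, on plain sets instead of a subtype depending on [P], so that
    components of different partitions have the same type. *)
Definition erel P : rel {set H} :=
  [rel S T | [&& S \in P, T \in P & ~~ (uniform S T && uniform T S)]].

Definition component P S : {set {set H}} := [set T | connect (erel P) S T].

Definition components P : {set {set {set H}}} := component P @: P.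

Lemma erel_sym P : connect_sym (erel P).
Proof.
by apply: sym_connect_sym => S T; rewrite /erel /= andbCA [uniform S T && _]andbC.
Qed.

Lemma mem_component P S : S \in component P S.
Proof. by rewrite inE connect0. Qed.

Lemma mem_components P S : S \in P -> component P S \in components P.
Proof. exact: imset_f. Qed.

Lemma component_sub P S : S \in P -> component P S \subset P.
Proof.
move=> SP; apply/subsetP => T; rewrite inE => ST.
suff cl : closed (erel P) P by rewrite -(closed_connect cl ST).
by move=> U U' /and3P[-> -> _].
Qed.

Lemma eq_component P S T : T \in component P S -> component P T = component P S.
Proof.
rewrite inE => ST; apply/setP => U.
by rewrite !inE (same_connect (@erel_sym P) ST).
Qed.

Lemma componentsP P C S : C \in components P -> S \in C -> C = component P S.
Proof. by move=> /imsetP[T _ ->] /eq_component. Qed.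

Lemma disjoint_components P C D :
  C \in components P -> D \in components P -> C != D -> [disjoint C & D].
Proof.
move=> CP DP CD; apply/pred0P => S; apply/negP => /= /andP[SC SD].
by case/eqP: CD; rewrite (componentsP CP SC) (componentsP DP SD).
Qed.

Lemma uniform_components P S T : S \in P -> T \in P ->
  component P S != component P T -> uniform S T.
Proof.
move=> SP TP; apply: contraR => nun; apply/eqP/esym/eq_component.
by rewrite inE connect1 // /erel /= SP TP (negPf nun).
Qed.

Lemma uniformS S T S' T' :
  S \subset S' -> T \subset T' -> uniform S' T' -> uniform S T.
Proof.
move=> /subsetP SS /subsetP TT /existsP[x /forall_inP h]; apply/existsP; exists x.
apply/forall_inP => u /SS/h/forall_inP h'; apply/forall_inP => v /TT.
exact: h'.
Qed.

(** The e-connected component in the contraction, viewed as a set of parts, is closed under [erel],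
    hence contains [component P S]. *)
Lemma card_component P S : S \in P ->
  #|component P S| <=
  @max_ecomponent (contraction P) (label H) (@lab (contraction P)).
Proof.
move=> SP; pose l : contraction P -> contraction P -> option (label H) :=
  @lab (contraction P).
pose x : contraction P := Sub S SP.
have lN (y z : contraction P) : (l y z == None) = ~~ uniform (val y) (val z).
  rewrite /l /= /contraction_lab; case: pickP => [t h|h] /=.
    by apply/esym/negbF/existsP; exists t.
  by apply/esym/existsPn => t; rewrite h.
apply: (@leq_trans #|val @: ecomponent l x|); last first.
  rewrite card_imset; last exact: val_inj.
  exact: (@leq_bigmax _ (fun u => #|ecomponent l u|) x).
apply/subset_leq_card/subsetP => T; rewrite inE => ST.
suff cl : closed (erel P) (val @: ecomponent l x).
  rewrite -(closed_connect cl ST); apply/imsetP.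
  by exists x => //; rewrite inE connect0.
apply: intro_closed; first exact: erel_sym.
move=> U U' /and3P[_ U'P nun] /imsetP[y]; rewrite inE => xy Uy.
apply/imsetP; exists (Sub U' U'P : contraction P) => //; rewrite inE.
apply: connect_trans xy (connect1 _).
by rewrite /eadj /= !lN -negb_and SubK -Uy.
Qed.

Lemma singletons_component v : component (singletons H) [set v] = [set [set v]].
Proof.
have un a b : uniform [set a] [set b].
  apply/existsP; exists (lab a b).
  by apply/forall_inP => ? /set1P->; apply/forall_inP => ? /set1P->.
apply/eqP; rewrite eqEsubset sub1set mem_component andbT.
apply/subsetP => T; rewrite inE => vT.
suff cl : closed (erel (singletons H)) [set [set v]].
  by rewrite -(closed_connect cl vT) inE.
move=> S S' /and3P[/imsetP[a _ ->] /imsetP[b _ ->]].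
by rewrite !un.
Qed.

(** Only the merged part has two preimages, so passing to preimages adds at most one part to a set
    [C]. *)
Lemma merge_stepP P Q : partition P [set: H] -> merge_step P Q -> exists pi : {set H} -> {set H},
  (forall S, S \in P -> pi S \in Q /\ S \subset pi S) /\
  (forall C, #|preparts P C pi| <= #|C|.+1).
Proof.
move=> /and3P[_ tP P0] /exists_inP[S1 S1P /exists_inP[S2 S2P /andP[S12 /eqP->]]].
pose U := S1 :|: S2.
exists (fun S => if (S == S1) || (S == S2) then U else S); split=> [S SP|C].
  case: ifP => [/orP[]/eqP->|]; first by rewrite setU11 subsetUl.
    by rewrite setU11 subsetUr.
  by move/norP=> [h1 h2]; rewrite !inE h1 h2 SP orbT.
have [UC|UC] := boolP (U \in C).
  apply: (@leq_trans #|S1 |: (S2 |: (C :\ U))|).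
    apply/subset_leq_card/subsetP => S; rewrite !inE => /andP[SP].
    case: eqP => //= S1N; case: eqP => //= _ SC; rewrite SC andbT.
    (* An old part equal to [U] would share a vertex with [S1], hence be [S1]. *)
    apply/eqP => SU; have [v v1] : exists v, v \in S1.
      by apply/set0Pn; apply: contraNneq P0 => <-.
    apply: S1N; rewrite -(def_pblock tP S1P v1); apply/esym/def_pblock => //.
    by rewrite SU inE v1.
  rewrite (leq_trans (leq_card_setU _ _)) // cards1 add1n ltnS.
  by rewrite (leq_trans (leq_card_setU _ _)) // cards1 (cardsD1 U C) UC.
apply: leq_trans (leqnSn _); apply/subset_leq_card/subsetP => S.
by rewrite !inE => /andP[_]; case: ifP => // _; rewrite (negPf UC).
Qed.

End Components.

(** * Tables of weights *)

Section TableProgram.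
Variables (H : elgraph) (X : finType) (R : {set X * label H}).
Implicit Types (P Q C D : {set {set H}}).

(** The rank is among all subsets of [H], not the parts of one partition, so a profile has the same
    code in every table. *)
Definition part_rank (o : option {set H}) : nat := enum_rank o.
Definition part_base : nat := #|{: option {set H}}|.

(** The successor keeps array 0 free for intermediate values and the output. The stage [k] is
    included because a component may persist through a merge, while each new table must start from
    zero. *)
Definition table_name (k : nat) C : nat := (pickle (k, C)).+1.

Lemma table_name_inj k k' C C' :
  table_name k C = table_name k' C' -> k = k' /\ C = C'.
Proof. by case=> /(pcan_inj (@pickleK _))[-> ->]. Qed.

Definition table_prog P C (pi : {set H} -> {set H}) (bads : seq (nat * nat * X))
    (vp : prog X H) (tgt : nat) : prog X H :=
  scatter_prog part_base #|preparts P C pi|.+1 bads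
    (fun a => part_rank (omap pi (part_of P C pi a))) vp tgt.

Definition table_cost P C (pi : {set H} -> {set H}) (bads : seq (nat * nat * X))
    (b : nat) : nat :=
  scatter_cost part_base #|preparts P C pi|.+1 bads
    (fun a => part_rank (omap pi (part_of P C pi a))) b.

Definition restrict_part D (o : option {set H}) : option {set H} :=
  if o is Some Y then if Y \in D then Some Y else None else None.

Fixpoint product_prog P C pi (k : nat) (Ds : seq {set {set H}}) : prog X H :=
  if Ds is D :: Ds' then
    Seq (Seq (code_prog X H part_base #|preparts P C pi|.+1
                (fun a => part_rank (restrict_part D (part_of P C pi a))))
             (SetA 0 (ICst X 0)
                (AMul (AGet H 0 (ICst X 0)) (AGet H (table_name k D) (ivar X 6)))))
        (product_prog P C pi k Ds')
  else Skip X H.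

Fixpoint product_cost P C pi (Ds : seq {set {set H}}) : nat :=
  if Ds is D :: Ds' then
    2 * icost (code_exp X part_base #|preparts P C pi|.+1
                (fun a => part_rank (restrict_part D (part_of P C pi a)))) + 31 +
    8 + product_cost P C pi Ds'
  else 1.

(** The label conflicts between parts related by [r], found from [H] and [R] alone and written into
    the program text. *)
Definition forbidden P C pi (r : rel {set H}) : seq (nat * nat * X) :=
  [seq (nat_of_ord t.1.1, nat_of_ord t.1.2, t.2)
     | t in [pred t : 'I_#|preparts P C pi|.+1 * 'I_#|preparts P C pi|.+1 * X |
       if part_of P C pi t.1.1 is Some Y then
         if part_of P C pi t.1.2 is Some Z then
           r Y Z && ~~ [forall a in Y, forall b in Z, (t.2, lab a b) \in R]
         else false
       else false]].

End TableProgram.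

Section Tables.
Variables (A : pzSemiRingType) (B : Type) (Om : premorphism A B).
Variables (H : elgraph) (X V : finType) (R : {set X * label H}).
Variable l : V -> V -> X.
Let G : elgraph := ELGraph l.
Variables (nu : 'I_#|G| -> G) (W : G -> H -> B).
Hypotheses (G_gt0 : 0 < #|G|) (nu_bij : bijective nu).
Local Notation n := #|G|.
Local Notation prof := (profile H l).
Local Notation run := (@runs A B Om H X V l nu W).
Local Notation wt := (@weight A B Om H X V R l W).
Implicit Types (C D P Q : {set {set H}}) (f : prof) (s : state A).

Definition pcode f : nat :=
  horner_code (part_base H) (vec nu (fun u => part_rank (f u))) n.

Lemma pcode_inj : injective pcode.
Proof.
move=> f1 f2; have [mu nuK muK] := nu_bij.
have lt f i : i < n -> vec nu (fun u => part_rank (f u)) i < part_base H.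
  by move=> i_n; rewrite (vecE _ _ (Ordinal i_n)) ltn_ord.
move=> /(horner_code_inj (lt f1) (lt f2)) E; apply/ffunP => u.
have := E _ (ltn_ord (mu u)); rewrite !vecE muK => /ord_inj.
exact: enum_rank_inj.
Qed.

Lemma vec_comp (h : nat -> nat) (w : G -> nat) i : i < n ->
  h (vec nu w i) = vec nu (h \o w) i.
Proof. by move=> i_n; rewrite !(vecE _ _ (Ordinal i_n)). Qed.

Lemma pcodeE (w : G -> nat) (h : nat -> nat) f :
  (forall u, h (w u) = part_rank (f u)) ->
  horner_code (part_base H) (h \o vec nu w) n = pcode f.
Proof.
move=> hw; apply: eq_horner_code => i i_n.
by rewrite /= vec_comp // !(vecE _ _ (Ordinal i_n)) /= hw.
Qed.

(** The accumulated sum is that of [weight_lift]: the skipped vectors have no compatible map, so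
    their weight is 0. *)
Lemma runs_table P Q C pi bads vp b tgt s0 :
  partition P [set: H] -> partition Q [set: H] ->
  (forall S, S \in P -> pi S \in Q /\ S \subset pi S) ->
  C \subset Q -> 0 < #|preparts P C pi| -> 0 < tgt ->
  (forall phi : {ffun G -> 'I_#|preparts P C pi|.+1},
     ~~ conflict_free nu bads (vec nu (fun u => phi u)) ->
     compat R (@profile_of H X V l P C pi phi) = set0) ->
  (forall (phi : {ffun G -> 'I_#|preparts P C pi|.+1}) s1,
     (forall i, i < n -> imem s1 0 i = vec nu (fun u => phi u) i) ->
     same_tables [:: 0; tgt] s0 s1 ->
     conflict_free nu bads (vec nu (fun u => phi u)) ->
     run vp (eq s1) (b * n)
       (fun s => [/\ keeps [:: 3; 6] s1 s, same_tables [:: 0] s1 s &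
          amem s 0 0 = wt (preparts P C pi) (@profile_of H X V l P C pi phi)])) ->
  (forall k, amem s0 tgt k = 0%R) ->
  run (table_prog P C pi bads vp tgt) (eq s0)
    (table_cost P C pi bads b * (#|preparts P C pi|.+1 ^ n * n ^ 2))
    (fun s => same_tables [:: 0; tgt] s0 s /\
       forall f, into C f -> amem s tgt (pcode f) = wt C f).
Proof.
move=> pP pQ piP CQ C0 tgt0 bad good z0.
apply: (runs_conseq _ _ _ (@runs_scatter A B Om H X V l nu W G_gt0 nu_bij
  _ _ _ _ _ _ b s0
  (fun phi => wt (preparts P C pi) (@profile_of H X V l P C pi phi)) _ _ _)) => //.
move=> s [h1 h2]; split=> // f fC.
rewrite h2 z0 GRing.add0r (weight_lift _ _ _ pP pQ piP CQ fC).
rewrite big_mkcond [RHS]big_mkcond; apply: eq_bigr => phi _.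
rewrite (@pcodeE _ _ (pushforward pi (profile_of phi))); last by move=> u; rewrite !ffunE.
rewrite (inj_eq pcode_inj) /=.
have [cf|cf] := boolP (conflict_free _ _ _) => //=.
by rewrite /weight (bad _ cf) omega0; case: eqP.
Qed.

Lemma conflict_free_forbidden P C pi (r : rel {set H})
    (phi : {ffun G -> 'I_#|preparts P C pi|.+1}) :
  reflect (forall u v S T, profile_of phi u = Some S -> profile_of phi v = Some T ->
             r S T -> @respects H X V R l u v S T)
          (conflict_free nu (forbidden R P C pi r) (vec nu (fun u => phi u))).
Proof.
apply: (iffP (conflict_freeP nu_bij _ _)) => [h u v S T|h u v].
  rewrite !ffunE => Eu Ev rST; apply: contraR (h u v) => nr.
  apply/imageP; exists (phi u, phi v, l u v) => //.
  by rewrite inE /= Eu Ev rST.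
apply/imageP => -[[[a b] x]]; rewrite inE /= => + [ea eb ex].
rewrite -ea -eb -ex; case Eu: part_of => [S|] //; case Ev: part_of => [T|] //.
by case/andP=> rST; rewrite [X in ~~ X](h u v S T) // ffunE.
Qed.

(** Between uniform parts a single label occurs, so if one compatible map exists, its pair of images
    shows that every pair of images is allowed. *)
Lemma compat_forbidden P C pi (r : rel {set H})
    (phi : {ffun G -> 'I_#|preparts P C pi|.+1}) :
  (forall S T, S \in preparts P C pi -> T \in preparts P C pi ->
     r S T -> uniform S T) ->
  ~~ conflict_free nu (forbidden R P C pi r) (vec nu (fun u => phi u)) ->
  compat R (@profile_of H X V l P C pi phi) = set0.
Proof.
move=> un; apply: contraNeq => /set0Pn[g]; rewrite inE => /andP[fg mg].
apply/conflict_free_forbidden => u v S T Eu Ev rST.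
have some w Z : profile_of phi w = Some Z -> exists2 a, g w = Some a & a \in Z.
  move=> E; case Eg: (g w) => [a|].
    by have [Z'] := follows_some fg Eg; rewrite E => -[->]; exists a.
  by rewrite (follows_none fg Eg) in E.
have [a ga aS] := some _ _ Eu; have [b gb bT] := some _ _ Ev.
have SP := intoP (into_profile_of _) Eu; have TP := intoP (into_profile_of _) Ev.
have /existsP[x /forall_inP hx] := un _ _ SP TP rST.
have xE c d : c \in S -> d \in T -> lab c d = x.
  by move=> /hx/forall_inP h /h/eqP.
have := partial_morphismP mg ga gb; rewrite (xE a b) // => inR.
by apply/forall_inP => c cS; apply/forall_inP => d dT; rewrite (xE c d).
Qed.

Lemma runs_product P C pi k Ds (phi : {ffun G -> 'I_#|preparts P C pi|.+1}) s1 :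
  (forall i, i < n -> imem s1 0 i = vec nu (fun u => phi u) i) ->
  (forall D, D \in Ds -> forall f, into D f ->
     amem s1 (table_name k D) (pcode f) = wt D f) ->
  run (product_prog X P C pi k Ds) (eq s1) (product_cost X P C pi Ds * n)
    (fun s => [/\ keeps [:: 3; 6] s1 s, same_tables [:: 0] s1 s &
       amem s 0 0 = (amem s1 0 0 *
         \prod_(D <- Ds) wt D (restrict D (@profile_of H X V l P C pi phi)))%R]).
Proof.
elim: Ds s1 => [|D Ds IH] s1 xs tabs.
  move=> _ <-; exists s1, 1; split; first exact: ESkip.
    by rewrite mul1n.
  by split=> //; rewrite big_nil GRing.mulr1.
set h := fun a => part_rank (restrict_part D (part_of P C pi a)).
move=> _ <-.
have [|sc [tc [Ec lc [kc ac cc]]]] :=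
    @runs_code A B Om H X V l nu W G_gt0 (part_base H) #|preparts P C pi|.+1 h s1 _ _ (erefl s1).
  by move=> i i_n; rewrite xs // (vecE _ _ (Ordinal i_n)).
have {}cc : imem sc 6 0 = pcode (restrict D (profile_of phi)).
  rewrite cc -(@pcodeE (fun u => phi u) h) => [|u]; last by rewrite !ffunE.
  by apply: eq_horner_code => i i_n; rewrite /= xs.
pose sm := State (imem sc) (set_cell (amem sc) 0 0
  (amem sc 0 0 * amem sc (table_name k D) (imem sc 6 0))%R).
have off a : a \notin [:: 0] -> forall j, amem sm a j = amem s1 a j.
  by rewrite inE => a0 j; rewrite /= /set_cell (negPf a0) /= ac.
have [||s [t [E lt [ks as_ vs]]]] := IH sm _ _ _ (erefl sm).
- by move=> i i_n; rewrite /= kc // xs.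
- move=> E EDs f fE; rewrite off ?inE //; apply: tabs => //.
  by rewrite inE EDs orbT.
exists s; eexists; split.
- apply: ESeq E; apply: ESeq Ec _.
  exact: (ESetA Om nu W sc 0 (ICst X 0)
    (AMul (AGet H 0 (ICst X 0)) (AGet H (table_name k D) (ivar X 6)))).
- have -> : product_cost X P C pi (D :: Ds) =
    2 * icost (code_exp X (part_base H) #|preparts P C pi|.+1 h) + 31 + 8 +
    product_cost X P C pi Ds by [].
  move: lc lt G_gt0; move: (icost (code_exp _ _ _ _)) => c0 /=.
  by rewrite !mulnDl; lia.
split.
- by apply: keeps_trans ks => // a j aN; rewrite /= kc.
- by move=> a j aN; rewrite as_ // off.
- rewrite vs /= /set_cell /= ac cc tabs ?mem_head ?into_restrict //.
  by rewrite big_cons GRing.mulrA.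
Qed.

(** * Tables after a merge, from those before it *)

Definition tables_for k P s : Prop :=
  forall C, C \in components P -> forall f, into C f ->
    amem s (table_name k C) (pcode f) = wt C f.

(** Labels uniform between two sets are uniform between their subsets, so e-adjacent old parts stay
    in one component after merging; the preimage of a component is thus a union of old
    components. *)
Lemma preparts_component P Q pi C S T :
  (forall S, S \in P -> pi S \in Q /\ S \subset pi S) ->
  C \in components Q -> S \in preparts P C pi -> T \in component P S ->
  T \in preparts P C pi.
Proof.
move=> piP CQ SC; rewrite inE => ST.
suff cl : closed (erel P) (preparts P C pi) by rewrite -(closed_connect cl ST).
apply: intro_closed; first exact: erel_sym.
move=> U U' /and3P[UP U'P nun]; rewrite !inE => /andP[_ UC]; rewrite U'P.
rewrite (componentsP CQ UC) inE connect1 // /erel /=.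
have [-> sU] := piP _ UP; have [-> sU'] := piP _ U'P.
by apply: contra nun => /andP[h1 h2]; rewrite (uniformS _ _ h1) ?(uniformS _ _ h2).
Qed.

Definition step_prog P pi (k : nat) C : prog X H :=
  let Ds := enum (component P @: preparts P C pi) in
  table_prog P C pi
    (forbidden R P C pi (fun S T => component P S != component P T))
    (Seq (SetA 0 (ICst X 0) (AOne X H)) (product_prog X P C pi k Ds))
    (table_name k.+1 C).

Definition step_cost P pi C : nat :=
  let Ds := enum (component P @: preparts P C pi) in
  table_cost P C pi
    (forbidden R P C pi (fun S T => component P S != component P T))
    (3 + product_cost X P C pi Ds).

Lemma preparts_gt0 P Q pi C : partition P [set: H] -> partition Q [set: H] ->
  (forall S, S \in P -> pi S \in Q /\ S \subset pi S) ->
  C \in components Q -> 0 < #|preparts P C pi|.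
Proof.
move=> pP pQ piP /imsetP[S SQ ->].
have [v vS] : exists v, v \in S.
  by apply/set0Pn; apply: contraTneq SQ => ->; case/and3P: pQ.
rewrite card_gt0; apply/set0Pn; exists (pblock P v); rewrite inE.
have [-> _] := part_pblock pP v.
by rewrite (pi_pblock pP pQ piP SQ vS) mem_component.
Qed.

Lemma runs_step P Q pi k C s0 :
  partition P [set: H] -> partition Q [set: H] ->
  (forall S, S \in P -> pi S \in Q /\ S \subset pi S) ->
  C \in components Q -> tables_for k P s0 ->
  (forall j, amem s0 (table_name k.+1 C) j = 0%R) ->
  run (step_prog P pi k C) (eq s0)
    (step_cost P pi C * (#|preparts P C pi|.+1 ^ n * n ^ 2))
    (fun s => same_tables [:: 0; table_name k.+1 C] s0 s /\
       forall f, into C f -> amem s (table_name k.+1 C) (pcode f) = wt C f).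
Proof.
move=> pP pQ piP CQ tabs z0.
have CQs : C \subset Q by case/imsetP: CQ => S SQ ->; apply: component_sub.
have C0 := preparts_gt0 pP pQ piP CQ.
have sP S : S \in preparts P C pi -> S \in P by rewrite inE => /andP[].
apply: (runs_table pP pQ piP CQs C0) => // phi.
  by apply: compat_forbidden => S T SC TC; apply: uniform_components; apply: sP.
move=> s1 xs same cf; set Ds := enum _.
have DsP D : D \in Ds -> exists2 S, S \in preparts P C pi & D = component P S.
  by rewrite mem_enum => /imsetP[S SC ->]; exists S.
have uE : unions Ds = preparts P C pi.
  apply/setP => S; rewrite mem_unions; apply/hasP/idP => [[D /DsP[T TC ->]]|SC].
    exact: (preparts_component piP CQ TC).
  by exists (component P S); rewrite ?mem_component // mem_enum imset_f.
pose s2 := State (imem s1) (set_cell (amem s1) 0 0 1%R).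
move=> _ <-.
have [||s [t [E lt [ks as_ vs]]]] := @runs_product P C pi k Ds phi s2 _ _ _ (erefl s2).
- by move=> i i_n; rewrite /= xs.
- move=> D /DsP[S SC ->] f fD; rewrite /= /set_cell /= same.
    by rewrite tabs ?mem_components ?sP.
  (* The tables that are read belong to stage [k], the target to stage [k.+1]. *)
  by rewrite !inE /=; apply/eqP => /table_name_inj[]; lia.
exists s; eexists; split.
- by apply: ESeq E; apply: (ESetA Om nu W s1 0 (ICst X 0) (AOne X H)).
- by move: lt G_gt0; rewrite /= mulnDl; lia.
split=> //.
  move=> a j aN; rewrite as_ // /= /set_cell.
  by move: aN; rewrite inE => /negPf->.
rewrite vs /= /set_cell /= GRing.mul1r -(weight_prod Om W pP) ?uE //.
- rewrite -size_eq0 -cardE -lt0n card_gt0; apply/set0Pn.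
  by case/card_gt0P: C0 => S SC; exists (component P S); rewrite imset_f.
- by apply/subsetP.
- apply: (@sub_in_pairwise _ (mem Ds) [rel C D | C != D]).
  + move=> D1 D2 /DsP[S SC ->] /DsP[T TC ->].
    by apply: (@disjoint_components _ P); rewrite mem_components ?sP.
  + exact/allP.
  + by rewrite -uniq_pairwise enum_uniq.
- exact: into_profile_of.
move=> u v S T Eu Ev nD.
(* The conflict test covers the pairs of parts in different old components, which are the pairs that
   [weight_prod] asks about. *)
move/conflict_free_forbidden: cf => /(_ u v S T Eu Ev); apply.
apply: contra nD => /eqP ST; apply/hasP; exists (component P S).
  by rewrite mem_enum imset_f // (intoP (into_profile_of _) Eu).
by rewrite mem_component ST mem_component.
Qed.

(** * Tables of the singletons, and the final read-out *)

Lemma preparts_singleton v :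
  preparts (singletons H) [set [set v]] id = [set [set v]].
Proof.
apply/setP => S; rewrite !inE; case: eqP => [->|]; rewrite ?andbF // andbT.
by apply/imsetP; exists v.
Qed.

Lemma compat_const v f : into [set [set v]] f ->
  (forall u u' S T, f u = Some S -> f u' = Some T -> @respects H X V R l u u' S T) ->
  compat R f = [set const_pfun (pdom f) v].
Proof.
move=> fv ok; have fE u : f u = if u \in pdom f then Some [set v] else None.
  by rewrite inE; case E: (f u) => [S|] //=; have /set1P-> := intoP fv E.
apply/setP => g; rewrite !inE; apply/andP/eqP => [[fg _]|->].
  apply/ffunP => u; rewrite ffunE; move/forallP: fg => /(_ u); rewrite fE.
  by case: ifP => _; case: (g u) => // a /set1P->.
split.
  apply/forallP => u; rewrite ffunE fE; case: ifP => // _.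
  exact: set11.
apply/forallP => u; apply/forallP => u'; rewrite !ffunE.
case: ifP => // du; case: ifP => // du'.
have /forall_inP/(_ v (set11 v))/forall_inP := ok u u' [set v] [set v]
  (etrans (fE u) (ifT _ _ du)) (etrans (fE u') (ifT _ _ du')).
by apply; exact: set11.
Qed.

(** The identity serves as merge, so there is one part and the digits are binary: the current vector
    is the indicator of the domain, in the format that the oracle reads. All pairs of vertices are
    tested for conflicts. *)
Definition leaf_prog v : prog X H :=
  table_prog (singletons H) [set [set v]] id
    (forbidden R (singletons H) [set [set v]] id (fun _ _ => true))
    (SetA 0 (ICst X 0) (AOmega X 0 v)) (table_name 0 [set [set v]]).

Definition leaf_cost v : nat :=
  table_cost (singletons H) [set [set v]] id
    (forbidden R (singletons H) [set [set v]] id (fun _ _ => true)) 4.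

Lemma runs_leaf v s0 : partition (singletons H) [set: H] ->
  (forall j, amem s0 (table_name 0 [set [set v]]) j = 0%R) ->
  run (leaf_prog v) (eq s0)
    (leaf_cost v * (#|preparts (singletons H) [set [set v]] id|.+1 ^ n * n ^ 2))
    (fun s => same_tables [:: 0; table_name 0 [set [set v]]] s0 s /\
       forall f, into [set [set v]] f ->
         amem s (table_name 0 [set [set v]]) (pcode f) = wt [set [set v]] f).
Proof.
move=> pP z0; have pre := preparts_singleton v.
have vP : [set v] \in singletons H by rewrite imset_f.
apply: (runs_table pP pP) => //.
- by rewrite sub1set.
- by rewrite pre cards1.
- move=> phi; apply: compat_forbidden => S T; rewrite pre.
  move=> /set1P-> /set1P-> _; apply/existsP; exists (lab v v).
  by apply/forall_inP => ? /set1P->; apply/forall_inP => ? /set1P->.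
move=> phi s1 xs same /conflict_free_forbidden cf _ <-.
eexists; eexists; split.
- exact: (ESetA Om nu W s1 0 (ICst X 0) (AOmega X 0 v)).
- by move: G_gt0; rewrite /=; lia.
split=> //.
  by move=> a j; rewrite inE /= /set_cell => /negPf->.
rewrite /= /set_cell /= /weight.
have -> : cover (preparts (singletons H) [set [set v]] id) = [set v].
  by rewrite pre /cover big_set1.
have pphi : into [set [set v]] (profile_of phi).
  by have := into_profile_of phi; rewrite [X in into X]pre.
rewrite (@compat_const v) //; last first.
  by move=> u u' S T Eu Ev; apply: cf Eu Ev _.
suff -> : stored_set nu s1 0 = pdom (profile_of phi) by [].
have [mu nuK muK] := nu_bij.
apply/setP => u; rewrite inE ffunE.
have -> : (part_of (singletons H) [set [set v]] id (phi u) != None) = (phi u != 0 :> nat).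
  congr (~~ _); apply/eqP/eqP => [E|->] //.
  exact: (@part_of_inj H (singletons H) [set [set v]] id (phi u) 0).
apply/imsetP/idP => [[i]|u0]; first by rewrite inE xs // vecE => ? ->.
by exists (mu u); rewrite ?muK // inE xs // vecE muK.
Qed.

(** The answer is the weight of the constant profile [[set: H]]. Its code is computed from the zero
    vector in base 1, whose only digit is mapped to the rank of [[set: H]]. *)
Definition output_prog (tgt : nat) : prog X H :=
  Seq (setup_prog X H 1)
    (Seq (code_prog X H (part_base H) 1 (fun _ => part_rank (Some [set: H])))
         (SetA 0 (ICst X 0) (AGet H tgt (ivar X 6)))).

Definition output_cost : nat :=
  2 * icost (iscale 1 (ivar X 2)) + 63 +
  (2 * icost (code_exp X (part_base H) 1 (fun _ => part_rank (Some [set: H]))) + 31) + 5.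

Lemma runs_output tgt s0 :
  run (output_prog tgt) (eq s0) (output_cost * n)
    (fun s => amem s 0 0 = amem s0 tgt (pcode [ffun => Some [set: H]])).
Proof.
move=> _ <-.
have [sa [ta [Ea la [aa _ xa]]]] := @runs_setup A B Om H X V l nu W G_gt0 1 s0 _ (erefl s0).
have [|sb [tb [Eb lb [_ ab cb]]]] := @runs_code A B Om H X V l nu W G_gt0 (part_base H) 1
  (fun _ => part_rank (Some [set: H])) sa _ _ (erefl sa).
  by move=> i i_n; rewrite xa.
eexists; eexists; split.
- apply: ESeq Ea _; apply: ESeq Eb _.
  exact: (ESetA Om nu W sb 0 (ICst X 0) (AGet H tgt (ivar X 6))).
- rewrite /output_cost; move: la lb G_gt0.
  move: (icost (code_exp _ _ _ _)) (icost (iscale _ _)) => c0 c1 /=.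
  by rewrite !mulnDl; lia.
rewrite /= /set_cell /= ab aa cb; congr (amem s0 tgt _).
by apply: eq_horner_code => i i_n; rewrite /= (vecE _ _ (Ordinal i_n)) ffunE.
Qed.

End Tables.

(** * The contraction sequence *)

Section Sequence.
Variables (A : pzSemiRingType) (B : Type) (Om : premorphism A B).
Variables (H : elgraph) (X : finType) (R : {set X * label H}) (w : nat).
Implicit Types (P Q C : {set {set H}}).

Definition assertion := forall (V : finType) (l : V -> V -> X)
  (nu : 'I_#|ELGraph l| -> ELGraph l) (W : ELGraph l -> H -> B), state A -> Prop.

(** The program and the constant come before the instance, so neither may depend on it. *)
Definition uniform_runs (c : prog X H) (K : nat) (pre post : assertion) : Prop :=
  forall (V : finType) (l : V -> V -> X)
    (nu : 'I_#|ELGraph l| -> ELGraph l) (W : ELGraph l -> H -> B),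
  0 < #|ELGraph l| -> bijective nu ->
  runs Om nu W c (@pre V l nu W)
    (K * ((w + 2) ^ #|ELGraph l| * #|ELGraph l| ^ 2)) (@post V l nu W).

Definition correct_table (k : nat) C : assertion := fun V l nu W s =>
  forall f : profile H l, into C f ->
    amem s (table_name k C) (pcode nu f) = weight Om R W C f.

Definition computes (base : assertion) (k : nat) C (c : prog X H) (K : nat) :=
  forall (V : finType) (l : V -> V -> X)
    (nu : 'I_#|ELGraph l| -> ELGraph l) (W : ELGraph l -> H -> B),
  0 < #|ELGraph l| -> bijective nu -> forall s0, @base V l nu W s0 ->
  (forall j, amem s0 (table_name k C) j = 0%R) ->
  runs Om nu W c (eq s0)
    (K * ((w + 2) ^ #|ELGraph l| * #|ELGraph l| ^ 2))
    (fun s => same_tables [:: 0; table_name k C] s0 s /\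
              @correct_table k C V l nu W s).

(** The programs run one after the other; each changes only array 0 and its own table, so [base] and
    the earlier results persist. *)
Lemma computes_all (base : assertion) (k : nat) (Cs : seq {set {set H}}) :
  (forall C V l nu W s s', @base V l nu W s ->
     same_tables [:: 0; table_name k C] s s' -> @base V l nu W s') ->
  uniq Cs -> (forall C, C \in Cs -> exists c K, computes base k C c K) ->
  exists c K, forall (V : finType) (l : V -> V -> X)
    (nu : 'I_#|ELGraph l| -> ELGraph l) (W : ELGraph l -> H -> B),
  0 < #|ELGraph l| -> bijective nu -> forall s0, @base V l nu W s0 ->
  (forall C, C \in Cs -> forall j, amem s0 (table_name k C) j = 0%R) ->
  runs Om nu W c (eq s0)
    (K * ((w + 2) ^ #|ELGraph l| * #|ELGraph l| ^ 2))
    (fun s => same_tables (0 :: map (table_name k) Cs) s0 s /\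
              forall C, C \in Cs -> @correct_table k C V l nu W s).
Proof.
move=> stable; elim: Cs => [_ _|C Cs IH /= /andP[CCs uCs] tasks].
  exists (Skip X H), 1 => V l nu W n0 nu_bij s0 _ _ _ <-.
  exists s0, 1; split=> //; first exact: ESkip.
  by rewrite mul1n muln_gt0 !expn_gt0 n0 addn2.
have [c1 [K1 h1]] := tasks C (mem_head _ _).
have [|c2 [K2 h2]] := IH uCs.
  by move=> D DCs; apply: tasks; rewrite inE DCs orbT.
exists (Seq c1 c2), (K1 + K2) => V l nu W n0 nu_bij s0 b0 z0 _ <-.
have [|s1 [t1 [E1 l1 [same1 tab1]]]] := h1 V l nu W n0 nu_bij s0 b0 _ _ (erefl s0).
  by apply: z0; rewrite mem_head.
have nameN D E : D != E -> table_name k D != table_name k E.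
  by apply: contra_neq => /table_name_inj[].
have b1 := stable _ _ _ _ _ _ _ b0 same1.
have [|s2 [t2 [E2 l2 [same2 tab2]]]] := h2 V l nu W n0 nu_bij s1 b1 _ _ (erefl s1).
  move=> D DCs j; rewrite same1 ?z0 ?inE ?DCs ?orbT //=.
  by apply: nameN; apply: contraNneq CCs => <-.
exists s2, (t1 + t2); split.
- exact: ESeq E1 E2.
- by rewrite mulnDl leq_add.
split=> [a j|D].
  rewrite !inE !negb_or => /and3P[a0 aC aCs].
  by rewrite same2 ?same1 ?inE ?negb_or ?a0 ?aC.
rewrite inE => /orP[/eqP->|]; last exact: tab2.
move=> f fC; rewrite same2 ?tab1 // inE /=.
by apply/mapP => -[E ECs /table_name_inj[_ CE]]; rewrite CE ECs in CCs.
Qed.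

(* Tables of later stages have not been written to yet. *)
Definition stage (k : nat) P : assertion := fun V l nu W s =>
  (forall C, C \in components P -> @correct_table k C V l nu W s) /\
  (forall k' C j, k < k' -> amem s (table_name k' C) j = 0%R).

Lemma leq_cost K q n m : q <= w + 2 ->
  K * (q ^ n * m) <= K * ((w + 2) ^ n * m).
Proof.
move=> qw; rewrite leq_mul2l leq_mul2r; apply/orP; right; apply/orP; right.
by case: n => // n; rewrite leq_exp2r.
Qed.

Lemma runs_first_stage : partition (singletons H) [set: H] ->
  exists c K, uniform_runs c K
    (fun V l nu W s => forall a j, amem s a j = 0%R) (stage 0 (singletons H)).
Proof.
move=> pP; pose base : assertion := fun _ _ _ _ _ => True.
have [||C|c [K h]] := @computes_all base 0 (enum (components (singletons H))).
- by [].
- exact: enum_uniq.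
- rewrite mem_enum => /imsetP[S /imsetP[v _ ->] ->].
  rewrite singletons_component; exists (leaf_prog R v), (leaf_cost R v).
  move=> V l nu W n0 nu_bij s0 _ z0.
  apply: (runs_conseq _ _ _ (runs_leaf Om R W n0 nu_bij pP z0)) => //.
  by apply: leq_cost; rewrite preparts_singleton cards1 addn2.
exists c, K => V l nu W n0 nu_bij s0 z0.
have [|s [t [E lt [same tabs]]]] := h V l nu W n0 nu_bij s0 I _ _ (erefl s0).
  by [].
exists s, t; split=> //; split=> [C CP|k' C j k0].
  by apply: tabs; rewrite mem_enum.
rewrite same ?z0 // inE /=; apply/mapP => -[D _ /table_name_inj[kk _]].
by rewrite kk in k0.
Qed.

Lemma runs_next_stage P Q k :
  partition P [set: H] -> partition Q [set: H] -> merge_step P Q ->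
  @max_ecomponent (contraction Q) (label H) (@lab (contraction Q)) <= w ->
  exists c K, uniform_runs c K (stage k P) (stage k.+1 Q).
Proof.
move=> pP pQ /(merge_stepP pP)[pi [piP card_pre]] Qw.
pose base : assertion := fun V l nu W s =>
  forall C, C \in components P -> @correct_table k C V l nu W s.
have [||C|c [K h]] := @computes_all base k.+1 (enum (components Q)).
- move=> C V l nu W s s' bs same D DP f fD; rewrite same ?bs //.
  by rewrite !inE /=; apply/eqP => /table_name_inj[]; lia.
- exact: enum_uniq.
- rewrite mem_enum => CQ; exists (step_prog R P pi k C), (step_cost R P pi C).
  move=> V l nu W n0 nu_bij s0 tabs z0.
  apply: (runs_conseq _ _ _ (runs_step n0 nu_bij pP pQ piP CQ tabs z0)) => //.
  (* The base [w + 2]: at most [w] parts in the component, one more before the merge, and the digit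
     for undefined. *)
  apply: leq_cost; rewrite addn2 ltnS (leq_trans (card_pre C)) // ltnS.
  case/imsetP: CQ => S SQ ->; exact: leq_trans (card_component SQ) Qw.
exists c, K => V l nu W n0 nu_bij s0 [tabs0 z0].
have [|s [t [E lt [same tabs]]]] := h V l nu W n0 nu_bij s0 tabs0 _ _ (erefl s0).
  by move=> C _ j; apply: z0.
exists s, t; split=> //; split=> [C CQ|k' C j k0].
  by apply: tabs; rewrite mem_enum.
rewrite same ?z0 ?(ltnW k0) // inE /=.
by apply/mapP => -[D _ /table_name_inj[kk _]]; rewrite kk ltnn in k0.
Qed.

Lemma uniform_runs_seq c1 c2 K1 K2 p1 p2 p3 :
  uniform_runs c1 K1 p1 p2 -> uniform_runs c2 K2 p2 p3 ->
  uniform_runs (Seq c1 c2) (K1 + K2) p1 p3.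
Proof.
move=> h1 h2 V l nu W n0 nu_bij; rewrite mulnDl.
by apply: runs_seq; [apply: h1|apply: h2].
Qed.

Lemma runs_stages Ps P k :
  partition P [set: H] -> all (fun Q => partition Q [set: H]) Ps ->
  path (@merge_step H) P Ps ->
  (forall Q, Q \in Ps ->
     @max_ecomponent (contraction Q) (label H) (@lab (contraction Q)) <= w) ->
  exists c K, uniform_runs c K (stage k P) (stage (k + size Ps) (last P Ps)).
Proof.
elim: Ps P k => [|Q Ps IH] P k pP /=.
  move=> _ _ _; exists (Skip X H), 1 => V l nu W n0 nu_bij s0 h.
  rewrite addn0; exists s0, 1; split=> //; first exact: ESkip.
  by rewrite mul1n muln_gt0 !expn_gt0 n0 addn2.
move=> /andP[pQ pPs] /andP[PQ QPs] wPs.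
have [|c1 [K1 h1]] := @runs_next_stage P Q k pP pQ PQ.
  by apply: wPs; rewrite mem_head.
have [|c2 [K2 h2]] := IH Q k.+1 pQ pPs QPs.
  by move=> Q' Q'Ps; apply: wPs; rewrite inE Q'Ps orbT.
exists (Seq c1 c2), (K1 + K2); rewrite addnS -addSn.
exact: uniform_runs_seq h1 h2.
Qed.

Lemma compat_full (V : finType) (l : V -> V -> X) :
  compat R ([ffun => Some [set: H]] : profile H l) =
  @morphisms (ELGraph l) H R.
Proof.
apply/setP => g; rewrite inE; apply/andP/imsetP => [[fg mg]|[f]].
  have some u : exists v, g u == Some v.
    move/forallP: fg => /(_ u); rewrite ffunE.
    by case: (g u) => // v _; exists v.
  pose f : {ffun ELGraph l -> H} := [ffun u => xchoose (some u)].
  have gE u : g u = Some (f u) by rewrite ffunE; apply/eqP/(xchooseP (some u)).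
  exists f; last by apply/ffunP => u; rewrite ffunE gE.
  rewrite inE; apply/forallP => u; apply/forallP => v.
  exact: partial_morphismP mg (gE u) (gE v).
rewrite inE => /forallP fm ->; split; apply/forallP => u.
  by rewrite !ffunE inE.
by apply/forallP => v; rewrite !ffunE; move/forallP: (fm u) => /(_ v).
Qed.

End Sequence.

Lemma partition_card1 (T : finType) (P : {set {set T}}) :
  partition P [set: T] -> #|P| = 1 -> P = [set [set: T]].
Proof.
move=> /and3P[/eqP cP _ _] /eqP/cards1P[S PS].
by rewrite PS -cP PS /cover big_set1.
Qed.

Theorem theorem4 (A : pzSemiRingType) (B : Type) (Om : premorphism A B)
    (H : elgraph) (s : seq {set {set H}})
    (s_opt : optimal_contraction_seq s)
    (X : finType) (R : {set X * label H}) :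
  exists (c : prog X H) (K : nat),
    forall (V : finType) (l : V -> V -> X) (G := ELGraph l)
           (nu : 'I_#|G| -> G) (W : G -> H -> B),
      0 < #|G| -> bijective nu ->
      @outputs_in_time A B Om G H nu W c
        (omega Om [set: G] [set: H] W (@morphisms G H R))
        (K * ((ctww H + 2) ^ #|G| * #|G| ^ 2)).
Proof.
case/andP: s_opt => /and4P[/eqP sz pS /forallP cards] + /eqP w_s.
case: s sz pS cards w_s => // P0 Ps sz /= /andP[pP0 pPs] cards w_s /andP[/eqP P0E mPs].
rewrite P0E in pP0 mPs.
have wPs Q : Q \in Ps ->
    @max_ecomponent (contraction Q) (label H) (@lab (contraction Q)) <= ctww H.
  by move=> QPs; rewrite -w_s /component_width /= (leq_bigmax_seq _ QPs).
have [c0 [K0 h0]] := @runs_first_stage A B Om H X R (ctww H) pP0.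
have [c1 [K1 h1]] := @runs_stages A B Om H X R (ctww H) Ps _ 0 pP0 pPs mPs wPs.
(* The partition at position [i] has [#|H| - i] parts, so the last one has a single part, namely
   [[set: H]]. *)
have lastE : last (singletons H) Ps = [set [set: H]].
  have lt : size Ps < size (P0 :: Ps) by [].
  have := cards (Ordinal lt); rewrite -sz /= subSnn -last_nth P0E => /eqP.
  apply: partition_card1.
  have := mem_last (singletons H) Ps; rewrite inE => /orP[/eqP->//|].
  by move/allP: pPs; apply.
pose tgt := table_name (0 + size Ps) [set [set: H]].
exists (Seq (Seq c0 c1) (output_prog H X tgt)), (K0 + K1 + output_cost H X).
move=> V l nu W n0 nu_bij.
have h01 := uniform_runs_seq h0 h1.
have [|s1 [t1 [E1 l1 [tabs _]]]] :=
  h01 V l nu W n0 nu_bij (init_state A) _.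
  by [].
have [s2 [t2 [E2 l2 out]]] := @runs_output A B Om H X V l nu W n0 tgt s1 s1 (erefl s1).
exists s2, (t1 + t2); split.
- exact: ESeq E1 E2.
- rewrite out tabs; last by apply/forallP => u; rewrite ffunE set11.
    rewrite /weight compat_full /cover big_set1; congr omega.
    by apply/setP => u; rewrite !inE ffunE.
  rewrite lastE; apply/imsetP; exists [set: H]; rewrite ?set11 //.
  apply/eqP; rewrite eqEsubset sub1set mem_component /= component_sub //.
  exact: set11.
(* The read-out is linear in [n], within the exponential bound for positive [n]. *)
rewrite mulnDl leq_add // (leq_trans l2) // leq_mul2l; apply/orP; right.
by rewrite -mulnn mulnA leq_pmull // muln_gt0 n0 expn_gt0 addn2.
Qed.
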